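(* Let $J=\left(\begin{smallmatrix}0&-1\\1&0\end{smallmatrix}\right)$ and let $\sigma:\mathbb{Z}/2\times\mathbb{Z}/2\to\mathbb{C}^*$ be the 2-cocycle $\sigma(a,b)=e^{\pi i ab}$. Consider the action of $\mathbb{Z}/2$ on $M_2(\mathbb{C})$ (concentrated in degree $0$) in which the generator acts by $\mathrm{Ad}_{J\mathbb{K}}$. Then there is an isomorphism of algebras $$M_2(\mathbb{C})\rtimes\mathbb{Z}/2\cong M_2(\mathbb{C})_\sigma[\mathbb{Z}/2].$$ If $(G,\phi)$ is a finite magnetic group and $G$ acts on $M_2(\mathbb{C})$ by the pullback along $\phi$ of this action, then $$M_2(\mathbb{C})\rtimes G\cong M_2(\mathbb{C})_{\phi^*\sigma}[G].$$ In particular, for all integers $p,q\ge 0$ there are induced isomorphisms of K-theory groups $$\mathbf{K}^{p,q+4}_{\mathbb{Z}/2}\cong{}^{\mathbb{Z}/4}\mathbf{K}^{p,q}_{\mathbb{Z}/2},\qquad \mathbf{K}^{p,q+4}_{G}\cong{}^{\widehat G}\mathbf{K}^{p,q}_{G},\qquad \mathbf{K}^{A^{p,q+4}}_{G}\cong\mathbf{K}^{A^{p,q}{}_{\phi^*\sigma}[G]}$$ for every magnetic $(G,\phi)$-equivariant central simple graded algebra $A$.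
   Context: A (finite) magnetic group $(G,\phi)$ is a finite group $G$ with a surjective homomorphism $\phi:G\to\mathbb{Z}/2=\{0,1\}$; $\mathbb{Z}/2$ is regarded as the magnetic group $(\mathbb{Z}/2,\mathrm{id})$. $\mathbb{K}$ is complex conjugation and $\mathbb{K}^{\phi(g)}$ is $\mathrm{id}$ if $\phi(g)=0$ and $\mathbb{K}$ if $\phi(g)=1$. $\mathrm{Ad}_{J\mathbb{K}}(C)=J\,\overline{C}\,J^{-1}$ with $\overline C$ the entrywise conjugate. $\phi^*\sigma(g,h)=\sigma(\phi(g),\phi(h))$. $\widehat G=\phi^*\mathbb{Z}/4$ is the pullback along $\phi$ of the extension $\mathbb{Z}/2\to\mathbb{Z}/4\to\mathbb{Z}/2$; it is the extension of $G$ by $\mathbb{Z}/2$ characterized by $\phi^*\sigma$. Algebras are finite-dimensional, associative, unital over $\mathbb{C}$, and graded means $\mathbb{Z}/2$-graded. A graded algebra is central if the elements commuting in the graded sense ($ab=(-1)^{\partial a\partial b}ba$ on homogeneous elements) with everything are exactly $\mathbb{C}$, and graded simple if it has no two-sided graded ideals other than $0$ and itself. $A\hat\otimes B$ has product $(a\otimes b)(a'\otimes b')=(-1)^{\partial a'\partial b}aa'\otimes bb'$. A magnetic $(G,\phi)$-equivariant central simple graded algebra is a central simple graded algebra $A$ over $\mathbb{C}$ with a $G$-action by degree-preserving ring automorphisms, $g$ acting $\mathbb{C}$-linearly if $\phi(g)=0$ and $\mathbb{C}$-antilinearly if $\phi(g)=1$. Clifford algebras. $C^{p,q}_{\mathbb{R}}$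 is generated by degree-one elements $e_1,\dots,e_{p+q}$ with $e_ie_j=-e_je_i$ for $i\neq j$, $e_j^2=1$ for $j\le p$ and $e_j^2=-1$ for $j>p$. $C^{p,q}_{\mathbb{C}}=C^{p,q}_{\mathbb{R}}\otimes_{\mathbb{R}}\mathbb{C}$, on which $g\in G$ acts by $\mathrm{id}\otimes\mathbb{K}^{\phi(g)}$. $A^{p,q}:=A\hat\otimes C^{p,q}_{\mathbb{C}}$ with $g(a\otimes b)=ga\otimes(\mathbb{K}^{\phi(g)}b)$. Crossed products. $A\rtimes G$ consists of linear combinations of elements $(a,g)$, $a\in A$, $g\in G$ (additive in $a$), with product $(a,g)(b,h)=(a(g\cdot b),gh)$. For a 2-cocycle $\rho:G\times G\to\mathbb{C}^*$ (for the action of $G$ on $\mathbb{C}^*$ by $\mathbb{K}^{\phi(g)}$), $B_\rho[G]$ consists of linear combinations of elements $\lfloor a,g\rfloor$, $a\in B$, $g\in G$, with product $\lfloor a,g\rfloor\lfloor b,h\rfloor=\lfloor\rho(g,h)\,a\,\overline{b}^{\phi(g)},gh\rfloor$, where: for $B=M_2(\mathbb{C})$, $\overline b^{\phi(g)}=\mathbb{K}^{\phi(g)}b$ with $\mathbb{K}$ entrywise conjugation; for $B=C^{p,q}_{\mathbb{C}}$, $\overline b^{\phi(g)}=(\mathrm{id}\otimes\mathbb{K}^{\phi(g)})b$; and for $B=A^{p,q}$ with $A$ an arbitrary equivariant algebra, $\overline{b}^{\phi(g)}$ is read as the given action $g\cdot b$. Both algebras are graded by the degree of $a$. Write $C^{p,q}_{\mathbb{C}}[G]$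 for the case $\rho=1$. K-theory. For a crossed product algebra $R$ ($=A\rtimes G$ or $B_\rho[G]$), let $\mathcal{E}^R$ be the category of finite-dimensional $\mathbb{Z}/2$-graded complex $R$-modules (elements indexed by $g$ act $\mathbb{C}$-linearly or antilinearly according to $\phi(g)$; complex scalars act as scalars of $B$, resp. $A$) with degree-zero module maps, $\overline{\mathcal{E}}^R$ the category with the same objects and all (not necessarily degree-zero) module maps, and $\varphi:\mathcal{E}^R\to\overline{\mathcal{E}}^R$ the forgetful functor. $\mathbf{K}^R$ is Karoubi's Grothendieck group of $\varphi$: it is generated by triples $(E,F,s)$ with $E,F$ objects of $\mathcal{E}^R$ and $s:\varphi E\to\varphi F$ an isomorphism; the sum is direct sum; triples $(E_0,F_0,s_0)$, $(E_1,F_1,s_1)$ are identified if homotopic, i.e. there are degree-zero isomorphisms $f:E_0\to E_1$, $g:F_0\to F_1$ and a continuous path of isomorphisms $\varphi E_0\to\varphi F_0$ from $s_0$ to $g^{-1}s_1f$; and elementary triples (those with $s$ of degree zero) are set to zero. For an equivariant algebra $A$, $\mathbf{K}^A_{(G,\phi)}=\mathbf{K}^A_G$ is defined the same way using finite-dimensional graded $A$-modules $V$ with a degree-preserving $G$-action satisfying $g(av)=(ga)(gv)$, and $G$-equivariant $A$-module maps. Finally $\mathbf{K}^{p,q}_G=\mathbf{K}^{C^{p,q}_{\mathbb{C}}[G]}$, ${}^{\widehat G}\mathbf{K}^{p,q}_G=\mathbf{K}^{(C^{p,q}_{\mathbb{C}})_{\phi^*\sigma}[G]}$ and ${}^{\mathbb{Z}/4}\mathbf{K}^{p,q}_{\mathbb{Z}/2}=\mathbf{K}^{(C^{p,q}_{\mathbb{C}})_{\sigma}[\mathbb{Z}/2]}$.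 *)

(* Defs.v *)
(* The complex numbers are R[i] for an arbitrary R : realType. Z/2 is bool with
   addb, both as a group and for degrees. *)
From HB Require Import structures.
From mathcomp Require Import all_boot all_order all_algebra all_fingroup.
From mathcomp Require Import all_solvable all_field complex.
From mathcomp Require Import boolp classical_sets set_interval reals topology.
From mathcomp Require Import normedtype trigo finset.

Set Implicit Arguments.
Unset Strict Implicit.
Unset Printing Implicit Defensive.

Import Order.TTheory GRing.Theory Num.Theory numFieldNormedType.Exports.

Local Open Scope ring_scope.

Section TwistedConvolution.
Variables (K : fieldType) (A : algType K) (I : finType).
Variables (op : I -> I -> I) (e : I).
Variables (c : I -> I -> K) (al : I -> A -> A).

(* Writing x = \sum_g x_g [g], this is the biadditive product determined by
   (a [g]) (b [h]) = c(g,h) a al_g(b) [op g h]. *)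
Definition tconv (x y : {ffun I -> A}) : {ffun I -> A} :=
  [ffun k => \sum_g \sum_(h | op g h == k) c g h *: (x g * al g (y h))].

(* The unit is c(e,e)^-1 [e] since c is not assumed to be normalized. *)
Definition tone : {ffun I -> A} :=
  [ffun g => if g == e then (c e e)^-1 *: 1 else 0].

Definition tsingle (a : A) (g : I) : {ffun I -> A} :=
  [ffun k => if k == g then a else 0].

Variable th : I -> K -> K.
Hypothesis opA : associative op.
Hypothesis op1 : left_id e op.
Hypothesis op1r : right_id e op.
Hypothesis thM : forall g, {morph th g : x y / x * y}.
Hypothesis th1 : forall g, th g 1 = 1.
Hypothesis the : th e =1 id.
Hypothesis alD : forall g, {morph al g : x y / x + y}.
Hypothesis alM : forall g, {morph al g : x y / x * y}.
Hypothesis al1 : forall g, al g 1 = 1.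
Hypothesis alZ : forall g k a, al g (k *: a) = th g k *: al g a.
Hypothesis alop : forall g h a, al (op g h) a = al g (al h a).
Hypothesis ale : al e =1 id.
Hypothesis c_neq0 : forall g h, c g h != 0.
Hypothesis cA : forall g h l,
  c g h * c (op g h) l = th g (c h l) * c g (op h l).

Lemma tconv_al0 g : al g 0 = 0.
Proof. by apply: (addrI (al g 0)); rewrite -alD !addr0. Qed.

Lemma tconv_al_sum g (J : Type) (r : seq J) (P : pred J) F :
  al g (\sum_(j <- r | P j) F j) = \sum_(j <- r | P j) al g (F j).
Proof. exact: (big_morph (al g) (alD g) (tconv_al0 g)). Qed.

Lemma tconvA : associative tconv.
Proof.
move=> x y z; apply/ffunP => k; rewrite !ffunE.
transitivity (\sum_g \sum_h \sum_(l | op (op g h) l == k)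
    (c g h * c (op g h) l) *: (x g * al g (y h) * al (op g h) (z l))).
  apply: eq_bigr => g _.
  transitivity (\sum_(m | op g m == k) \sum_h \sum_(l | op h l == m)
     (c g h * c (op g h) l) *: (x g * al g (y h) * al (op g h) (z l))).
    apply: eq_bigr => m _; rewrite ffunE tconv_al_sum mulr_sumr scaler_sumr.
    apply: eq_bigr => h _; rewrite tconv_al_sum mulr_sumr scaler_sumr.
    apply: eq_bigr => l /eqP <-; rewrite alZ alM -scalerAr scalerA alop mulrA.
    by rewrite mulrC cA.
  rewrite exchange_big /=; apply: eq_bigr => h _.
  rewrite (exchange_big_dep xpredT) //= [RHS]big_mkcond /=.
  apply: eq_bigr => l _; rewrite (eq_bigl (fun m => (m == op h l) && (op g m == k))); last first.
    by move=> m; rewrite andbC eq_sym.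
  rewrite big_mkcondr big_pred1_eq opA.
  by case: ifP.
symmetry.
transitivity (\sum_m \sum_g \sum_(h | op g h == m) \sum_(l | op m l == k)
    (c g h * c m l) *: (x g * al g (y h) * al m (z l))).
  apply: eq_bigr => m _.
  transitivity (\sum_(l | op m l == k) \sum_g \sum_(h | op g h == m)
     (c g h * c m l) *: (x g * al g (y h) * al m (z l))).
    apply: eq_bigr => l _; rewrite ffunE mulr_suml scaler_sumr.
    apply: eq_bigr => g _; rewrite mulr_suml scaler_sumr.
    by apply: eq_bigr => h _; rewrite -scalerAl scalerA mulrC.
  rewrite exchange_big /=; apply: eq_bigr => g _.
  by rewrite exchange_big.
rewrite exchange_big /=; apply: eq_bigr => g _.
rewrite (exchange_big_dep xpredT) //=; apply: eq_bigr => h _.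
by rewrite (eq_bigl (pred1 (op g h))) ?big_pred1_eq // => m; rewrite /= eq_sym.
Qed.

Lemma tconv_c1 h : c e h = c e e.
Proof.
have := cA e e h; rewrite !op1 the [RHS]mulrC.
by move/(mulIf (c_neq0 e h)).
Qed.

Lemma tconv_cr1 g : c g e = th g (c e e).
Proof. by have := cA g e e; rewrite !op1r => /(mulIf (c_neq0 g e)). Qed.

Lemma tconv1 : left_id tone tconv.
Proof.
move=> x; apply/ffunP => k; rewrite ffunE (bigD1 e) //= [X in _ + X]big1 => [|g].
  rewrite addr0 (eq_bigl (pred1 k)); last by move=> h; rewrite op1.
  rewrite big_pred1_eq ffunE eqxx tconv_c1 ale -scalerAl mul1r scalerA mulfV //.
  by rewrite scale1r.
move=> ge; apply: big1 => h _.
by rewrite ffunE (negPf ge) mul0r scaler0.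
Qed.

Lemma tconv1r : right_id tone tconv.
Proof.
move=> x; apply/ffunP => k; rewrite ffunE (exchange_big_dep xpredT) //=.
rewrite (bigD1 e) //= [X in _ + X]big1 => [|g ge]; last first.
  by apply: big1 => h _; rewrite ffunE (negPf ge) tconv_al0 mulr0 scaler0.
rewrite addr0 (eq_bigl (pred1 k)) ?big_pred1_eq; last by move=> h; rewrite op1r.
rewrite ffunE eqxx tconv_cr1 alZ al1 -scalerAr mulr1 scalerA -thM mulfV //.
by rewrite th1 scale1r.
Qed.

Lemma tconvDl : left_distributive tconv +%R.
Proof.
move=> x y z; apply/ffunP => k; rewrite !ffunE -big_split /=.
apply: eq_bigr => g _; rewrite -big_split /=; apply: eq_bigr => h _.
by rewrite ffunE mulrDl scalerDr.
Qed.

Lemma tconvDr : right_distributive tconv +%R.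
Proof.
move=> x y z; apply/ffunP => k; rewrite !ffunE -big_split /=.
apply: eq_bigr => g _; rewrite -big_split /=; apply: eq_bigr => h _.
by rewrite ffunE alD mulrDr scalerDr.
Qed.

Lemma tone_neq0 : tone != 0.
Proof.
apply/eqP => /ffunP /(_ e); rewrite !ffunE eqxx => /eqP.
by rewrite scaler_eq0 invr_eq0 (negPf (c_neq0 e e)) oner_eq0.
Qed.

Lemma tconvZl k x y : k *: tconv x y = tconv (k *: x) y.
Proof.
apply/ffunP => m; rewrite !ffunE scaler_sumr; apply: eq_bigr => g _.
rewrite scaler_sumr; apply: eq_bigr => h _.
by rewrite ffunE -scalerAl !scalerA mulrC.
Qed.

Lemma tconvZr k x y : (forall g, th g =1 id) ->
  k *: tconv x y = tconv x (k *: y).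
Proof.
move=> thid; apply/ffunP => m; rewrite !ffunE scaler_sumr; apply: eq_bigr => g _.
rewrite scaler_sumr; apply: eq_bigr => h _.
by rewrite ffunE alZ thid -scalerAr !scalerA mulrC.
Qed.

Lemma tconv_single a b g h :
  tconv (tsingle a g) (tsingle b h) = tsingle (c g h *: (a * al g b)) (op g h).
Proof.
apply/ffunP => k; rewrite !ffunE (bigD1 g) //= [X in _ + X]big1 => [|g' gg].
  rewrite addr0 big_mkcond /= (bigD1 h) //= [X in _ + X]big1 => [|h' hh].
    by rewrite !ffunE !eqxx addr0 eq_sym.
  by rewrite !ffunE eqxx (negPf hh) tconv_al0 mulr0 scaler0 if_same.
by apply: big1 => h' _; rewrite ffunE (negPf gg) mul0r scaler0.
Qed.

End TwistedConvolution.

Definition is_grading (K : fieldType) (V : vectType K)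
    (gr : bool -> {vspace V}) : Prop :=
  (gr false + gr true)%VS = fullv /\ (gr false :&: gr true)%VS = 0%VS.

Record galg (K : fieldType) := GAlg {
  galg_sort :> falgType K;
  gr : bool -> {vspace galg_sort};
  gr_grading : is_grading gr;
  gr1 : 1 \in gr false;
  grM : forall i j a b, a \in gr i -> b \in gr j -> a * b \in gr (i (+) j) }.

Arguments gr {K} g i.

Section GradedAlgebra.
Variables (K : fieldType) (A : galg K).

(* By linearity it suffices to test homogeneous elements. *)
Definition graded_central : Prop :=
  forall i (a : A), a \in gr A i ->
    ((forall j (b : A), b \in gr A j -> a * b = (-1) ^+ (i && j) * (b * a))
     <-> a \in 1%VS).

Definition graded_simple : Prop :=
  forall I : {vspace A},
    (forall a b : A, b \in I -> a * b \in I /\ b * a \in I) ->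
    I = ((I :&: gr A false) + (I :&: gr A true))%VS ->
    I = 0%VS \/ I = fullv.

Definition gcomp (i : bool) (a : A) : A := daddv_pi (gr A i) (gr A (~~ i)) a.

(* a |-> (-1)^(e da) a, the Koszul sign of moving a past an element of
   degree e. *)
Definition ksign (e : bool) (a : A) : A :=
  \sum_(i : bool) (-1) ^+ (i && e) *: gcomp i a.

Lemma gr_disj i : (gr A i :&: gr A (~~ i) = 0)%VS.
Proof. by case: i; case: (gr_grading A) => // _; rewrite capvC. Qed.

Lemma gcomp_gr i a : gcomp i a \in gr A i.
Proof. exact: memv_pi. Qed.

Lemma gcomp_id i a : a \in gr A i -> gcomp i a = a.
Proof. exact/daddv_pi_id/gr_disj. Qed.

Lemma gcomp_sum a : gcomp true a + gcomp false a = a.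
Proof.
rewrite addrC /gcomp /=; apply: daddv_pi_add (gr_disj false) _.
by case: (gr_grading A) => -> _; rewrite memvf.
Qed.

Lemma gcomp0 i a : a \in gr A i -> gcomp (~~ i) a = 0.
Proof.
move=> ai; have := gcomp_sum a; case: i ai => ai; rewrite (gcomp_id ai).
  by rewrite -[RHS]addr0 => /addrI.
by rewrite -[RHS]add0r => /addIr.
Qed.

Lemma ksignE e i a : a \in gr A i -> ksign e a = (-1) ^+ (i && e) *: a.
Proof.
move=> ai; rewrite /ksign big_bool /=.
by case: i ai => ai; rewrite (gcomp_id ai) (gcomp0 ai) scaler0 ?add0r ?addr0.
Qed.

Lemma ksignD e : {morph ksign e : a b / a + b}.
Proof.
move=> a b; rewrite /ksign -big_split; apply: eq_bigr => i _ /=.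
by rewrite /gcomp linearD scalerDr.
Qed.

Lemma ksignZ e k a : ksign e (k *: a) = k *: ksign e a.
Proof.
rewrite /ksign scaler_sumr; apply: eq_bigr => i _.
by rewrite /gcomp linearZ /= !scalerA mulrC.
Qed.

Lemma gr_ind (P : A -> Prop) :
  (forall a b, P a -> P b -> P (a + b)) -> (forall i a, a \in gr A i -> P a) ->
  forall a, P a.
Proof. by move=> PD Ph a; rewrite -(gcomp_sum a); apply: PD; apply: (Ph _ _ (gcomp_gr _ _)). Qed.

Lemma ksignM e : {morph ksign e : a b / a * b}.
Proof.
elim/gr_ind => [a a' IH IH' b|i a ai].
  by rewrite mulrDl !ksignD mulrDl IH IH'.
elim/gr_ind => [b b' IH IH'|j b bj].
  by rewrite mulrDr !ksignD mulrDr IH IH'.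
rewrite (ksignE e ai) (ksignE e bj) (ksignE e (grM ai bj)).
rewrite -scalerAl -scalerAr scalerA -signr_addb.
by rewrite andb_addl.
Qed.

Lemma ksign1 e : ksign e 1 = 1.
Proof. by rewrite (ksignE e (gr1 A)) scale1r. Qed.

Lemma ksign_false : ksign false =1 id.
Proof.
elim/gr_ind => [a b IHa IHb|i a ai]; first by rewrite ksignD IHa IHb.
by rewrite (ksignE _ ai) andbF scale1r.
Qed.

Lemma ksign_comp d e a : ksign (d (+) e) a = ksign d (ksign e a).
Proof.
elim/gr_ind: a => [a b IHa IHb|i a ai]; first by rewrite !ksignD IHa IHb.
rewrite !(ksignE _ ai) ksignZ (ksignE _ ai) scalerA -signr_addb.
by rewrite -andb_addr addbC.
Qed.

Lemma ksign_gr e i a : a \in gr A i -> ksign e a \in gr A i.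
Proof. by move=> ai; rewrite (ksignE e ai) memvZ. Qed.

End GradedAlgebra.

Section Ungraded.
Variables (K : fieldType) (A : falgType K).

Definition gr0 (i : bool) : {vspace A} := if i then 0%VS else fullv.

Lemma gr0_grading : is_grading gr0.
Proof. by split; rewrite /gr0 ?addv0 ?capv0. Qed.

Lemma gr0_1 : 1 \in gr0 false.
Proof. exact: memvf. Qed.

Lemma gr0M i j (a b : A) :
  a \in gr0 i -> b \in gr0 j -> a * b \in gr0 (i (+) j).
Proof.
rewrite /gr0; case: i j => [] [] //=; rewrite ?memv0 ?memvf //.
- by move=> /eqP -> _; rewrite mul0r.
- by move=> _ /eqP ->; rewrite mulr0.
Qed.

Definition ungraded : galg K := GAlg gr0_grading gr0_1 gr0M.

End Ungraded.

Record magnetic := Magnetic {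
  mag_group :> finGroupType;
  phi : mag_group -> bool;
  phiM : {morph phi : g h / (g * h)%g >-> g (+) h};
  phi_surj : forall b, exists g, phi g = b }.

Arguments phi {m} g.

Definition magZ2 : magnetic :=
  @Magnetic bool id (fun _ _ => erefl) (fun b => ex_intro _ b erefl).

Lemma phi1 (G : magnetic) : phi (1%g : G) = false.
Proof. by have := phiM (1%g : G) 1%g; rewrite mulg1; case: (phi _). Qed.

(* K^b, for K the complex conjugation *)
Definition conjb (R : realType) (b : bool) (z : R[i]) : R[i] :=
  if b then conjc z else z.

Section Conjb.
Variable R : realType.
Implicit Types (b : bool) (z : R[i]).

Lemma conjbD b : {morph conjb b : z w / z + w :> R[i]}.
Proof. by case: b => // z w; rewrite /conjb rmorphD. Qed.
Lemma conjbM b : {morph conjb b : z w / z * w :> R[i]}.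
Proof. by case: b => // z w; rewrite /conjb rmorphM. Qed.
Lemma conjb1 b : conjb b 1 = 1 :> R[i].
Proof. by case: b; rewrite /conjb ?rmorph1. Qed.
Lemma conjb_sign b n : conjb b ((-1) ^+ n) = (-1) ^+ n :> R[i].
Proof. by case: b => //; rewrite /conjb rmorphXn rmorphN rmorph1. Qed.
Lemma conjb_addb b c z : conjb (b (+) c) z = conjb b (conjb c z).
Proof. by case: b c => [] []; rewrite /conjb /= ?conjcK. Qed.
End Conjb.

Record magalg (R : realType) (G : magnetic) := MagAlg {
  ma_alg :> galg R[i];
  ma_act : G -> ma_alg -> ma_alg;
  ma_actD : forall g, {morph ma_act g : a b / a + b};
  ma_actM : forall g, {morph ma_act g : a b / a * b};
  ma_act1 : forall g, ma_act g 1 = 1;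
  ma_actZ : forall g z a, ma_act g (z *: a) = conjb (phi g) z *: ma_act g a;
  ma_act_id : ma_act 1%g =1 id;
  ma_act_mulg : forall g h a, ma_act (g * h)%g a = ma_act g (ma_act h a);
  ma_act_gr : forall g i a, a \in gr ma_alg i -> ma_act g a \in gr ma_alg i }.

Section Pullback.
Variables (R : realType) (G : magnetic) (A : magalg R magZ2).

Definition pullback_act (g : G) : A -> A := ma_act (phi g : magZ2).

Lemma pullback_act_id : pullback_act 1%g =1 id.
Proof. by move=> a; rewrite /pullback_act phi1; apply: ma_act_id. Qed.

Lemma pullback_act_mulg g h a :
  pullback_act (g * h)%g a = pullback_act g (pullback_act h a).
Proof. by rewrite /pullback_act phiM; apply: ma_act_mulg. Qed.

Definition pullback_alg : magalg R G :=
  @MagAlg R G A pullback_act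
    (fun g => @ma_actD R magZ2 A (phi g)) (fun g => @ma_actM R magZ2 A (phi g))
    (fun g => @ma_act1 R magZ2 A (phi g)) (fun g => @ma_actZ R magZ2 A (phi g))
    pullback_act_id pullback_act_mulg
    (fun g => @ma_act_gr R magZ2 A (phi g)).

End Pullback.

Record cocycle (R : realType) (G : magnetic) := Cocycle {
  cc :> G -> G -> R[i];
  cc_neq0 : forall g h, cc g h != 0;
  ccP : forall g h k,
    cc g h * cc (g * h)%g k = conjb (phi g) (cc h k) * cc g (h * k)%g }.

Lemma one_ccP (R : realType) (G : magnetic) (g h k : G) :
  1 * 1 = conjb (phi g) 1 * 1 :> R[i].
Proof. by rewrite conjb1. Qed.

Definition one_cc (R : realType) (G : magnetic) : cocycle R G :=
  @Cocycle R G (fun _ _ => 1) (fun _ _ => oner_neq0 _) (@one_ccP R G).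

Lemma pullback_ccP (R : realType) (G : magnetic) (rho : cocycle R magZ2)
  (g h k : G) : rho (phi g) (phi h) * rho (phi (g * h)%g) (phi k) =
    conjb (phi g) (rho (phi h) (phi k)) * rho (phi g) (phi (h * k)%g).
Proof. by rewrite !phiM; apply: (ccP rho). Qed.

Definition pullback_cc (R : realType) (G : magnetic) (rho : cocycle R magZ2) :
    cocycle R G :=
  @Cocycle R G (fun g h => rho (phi g) (phi h))
    (fun g h => cc_neq0 rho (phi g) (phi h)) (pullback_ccP rho).

(* e^(pi i a b) *)
Definition sigma_fun (R : realType) (a b : bool) : R[i] :=
  (cos (pi * (a * b)%N%:R) +i* sin (pi * (a * b)%N%:R))%C.

Lemma sigma_funE (R : realType) a b : sigma_fun R a b = (-1) ^+ (a && b).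
Proof.
rewrite /sigma_fun; case: a b => [] [] /=; rewrite ?mulr1 ?mulr0.
- by rewrite cospi sinpi expr1; apply/eqP; rewrite eq_complex /= oppr0 !eqxx.
- by rewrite cos0 sin0.
- by rewrite cos0 sin0.
- by rewrite cos0 sin0.
Qed.

Lemma sigma_neq0 (R : realType) (a b : magZ2) : sigma_fun R a b != 0.
Proof. by rewrite sigma_funE signr_eq0. Qed.

Lemma sigmaP (R : realType) (a b c : magZ2) :
  sigma_fun R a b * sigma_fun R (a * b)%g c =
  conjb (phi a) (sigma_fun R b c) * sigma_fun R a (b * c)%g.
Proof.
rewrite !sigma_funE; have -> : (a * b)%g = a (+) b by [].
have -> : (b * c)%g = b (+) c by [].
rewrite conjb_sign -!signr_addb; congr ((-1) ^+ nat_of_bool _).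
by case: a b c => [] [] [].
Qed.

Definition sigma (R : realType) : cocycle R magZ2 :=
  Cocycle (@sigma_neq0 R) (@sigmaP R).

(* A_rho[G] for the given action of G on A; the element [x] stands for
   \sum_g |x g, g|, see [crossed_singleM]. *)
Definition crossed (R : realType) (G : magnetic) (A : magalg R G)
  (rho : cocycle R G) : Type := {ffun G -> A}.

Section Crossed.
Variables (R : realType) (G : magnetic) (A : magalg R G) (rho : cocycle R G).

HB.instance Definition _ := Vector.copy (crossed A rho) {ffun G -> A}.

Definition crossed_mul : crossed A rho -> crossed A rho -> crossed A rho :=
  tconv (@mulg G) rho (@ma_act R G A).
Definition crossed_one : crossed A rho := tone A (1%g : G) rho.

Definition crossed_single (a : A) (g : G) : crossed A rho := tsingle a g.

Lemma crossed_mulA : associative crossed_mul.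
Proof.
exact: (tconvA (@mulgA G) (@ma_actD R G A) (@ma_actM R G A) (@ma_actZ R G A)
  (@ma_act_mulg R G A) (ccP rho)).
Qed.

Let the : conjb (phi (1%g : G)) =1 @id R[i].
Proof. by move=> z; rewrite phi1. Qed.

Lemma crossed_mul1 : left_id crossed_one crossed_mul.
Proof.
exact: (tconv1 (th := fun g : G => conjb (phi g)) (@mul1g G) the (@ma_act_id R G A) (cc_neq0 rho) (ccP rho)).
Qed.

Lemma crossed_mul1r : right_id crossed_one crossed_mul.
Proof.
exact: (tconv1r (th := fun g : G => conjb (phi g)) (@mulg1 G) (fun g => @conjbM R (phi g))
  (fun g => @conjb1 R (phi g)) (@ma_actD R G A) (@ma_act1 R G A)
  (@ma_actZ R G A) (cc_neq0 rho) (ccP rho)).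
Qed.

Lemma crossed_mulDl : left_distributive crossed_mul +%R.
Proof. exact: tconvDl. Qed.

Lemma crossed_mulDr : right_distributive crossed_mul +%R.
Proof. exact/tconvDr/ma_actD. Qed.

Lemma crossed_one_neq0 : crossed_one != 0.
Proof. exact: tone_neq0 (cc_neq0 rho). Qed.

HB.instance Definition _ := GRing.Zmodule_isNzRing.Build (crossed A rho)
  crossed_mulA crossed_mul1 crossed_mul1r crossed_mulDl crossed_mulDr
  crossed_one_neq0.

Lemma crossed_mulZl (z : R[i]) (x y : crossed A rho) : z *: (x * y) = z *: x * y.
Proof. exact: tconvZl. Qed.

(* C acts by left multiplication; it is not central when antilinear elements
   are present, so this is only a left algebra. *)
HB.instance Definition _ :=
  GRing.Lmodule_isLalgebra.Build R[i] (crossed A rho) crossed_mulZl.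

Lemma crossed_singleM (a b : A) (g h : G) :
  crossed_single a g * crossed_single b h =
  crossed_single (rho g h *: (a * ma_act g b)) (g * h)%g.
Proof. exact/tconv_single/ma_actD. Qed.

End Crossed.

Definition semidirect (R : realType) (G : magnetic) (A : magalg R G) :=
  crossed A (one_cc R G).

Section CliffordSigns.
Variables (K : fieldType) (p q : nat).
Implicit Types (i j : 'I_(p + q)) (S T : {set 'I_(p + q)}).

Definition symd S T := (S :\: T) :|: (T :\: S).

Lemma in_symd S T i : (i \in symd S T) = (i \in S) (+) (i \in T).
Proof. by rewrite !inE; case: (i \in S); case: (i \in T). Qed.

Lemma symdA : associative symd.
Proof. by move=> S T U; apply/setP => i; rewrite !in_symd addbA. Qed.

Lemma symd0 : left_id set0 symd.
Proof. by move=> S; apply/setP => i; rewrite in_symd inE. Qed.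

Lemma symd0r : right_id set0 symd.
Proof. by move=> S; apply/setP => i; rewrite in_symd inE addbF. Qed.

Lemma odd_symd S T : odd #|symd S T| = odd #|S| (+) odd #|T|.
Proof.
rewrite -(cardsID T S) -(cardsID S T) !oddD (setIC T S) cardsU.
have -> : (S :\: T) :&: (T :\: S) = set0.
  by apply/setP => i; rewrite !inE; case: (i \in S); case: (i \in T).
by rewrite cards0 subn0 oddD; case: (odd #|S :&: T|); case: (odd _); case: (odd _).
Qed.

(* The sign contributed by e_i in S and e_j in T when the product of
   e_S = \prod_(i in S) e_i (increasing order) and e_T is brought to the form
   +- e_(symd S T): moving e_j to its place crosses every e_i with j < i, and
   e_i ^+ 2 is 1 for i < p and -1 for p <= i. *)
Definition cl_pair i j : K := if (j < i)%N || (i == j) && (p <= i)%N then -1 else 1.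

Definition cl_sign S T : K := \prod_(i in S) \prod_(j in T) cl_pair i j.

Lemma cl_pair_sq i j : cl_pair i j * cl_pair i j = 1.
Proof. by rewrite /cl_pair; case: ifP; rewrite ?mulrNN mulr1. Qed.

Lemma cl_prod_symd (f : 'I_(p + q) -> K) S T : (forall i, f i * f i = 1) ->
  \prod_(i in symd S T) f i = \prod_(i in S) f i * \prod_(i in T) f i.
Proof.
move=> ff; rewrite big_mkcond [X in X * _]big_mkcond [X in _ * X]big_mkcond.
rewrite -big_split; apply: eq_bigr => i _ /=; rewrite in_symd.
by case: (i \in S); case: (i \in T); rewrite /= ?ff ?mulr1 ?mul1r.
Qed.

Lemma cl_sign_sq S T : cl_sign S T * cl_sign S T = 1.
Proof.
rewrite /cl_sign -big_split big1 // => i _ /=.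
by rewrite -big_split big1 // => j _; apply: cl_pair_sq.
Qed.

Lemma cl_sign_neq0 S T : cl_sign S T != 0.
Proof.
by apply/eqP => c0; have /eqP := cl_sign_sq S T; rewrite c0 mul0r eq_sym oner_eq0.
Qed.

Lemma cl_sign_symdl S T U : cl_sign (symd S T) U = cl_sign S U * cl_sign T U.
Proof.
apply: cl_prod_symd => i.
by rewrite -big_split big1 // => j _; apply: cl_pair_sq.
Qed.

Lemma cl_sign_symdr S T U : cl_sign S (symd T U) = cl_sign S T * cl_sign S U.
Proof.
rewrite /cl_sign -big_split; apply: eq_bigr => i _.
exact/cl_prod_symd/cl_pair_sq.
Qed.

Lemma cl_signP S T U :
  cl_sign S T * cl_sign (symd S T) U = cl_sign T U * cl_sign S (symd T U).
Proof. by rewrite cl_sign_symdl cl_sign_symdr mulrA mulrC. Qed.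

Lemma cl_sign0 T : cl_sign set0 T = 1.
Proof. by rewrite /cl_sign big_set0. Qed.

End CliffordSigns.

(* A (x)^ C^{p,q}: the free A-module on the basis e_S, S a set of generators,
   of C^{p,q}; the element [x] stands for \sum_S x S (x) e_S. For A the ground
   field, this is the Clifford algebra itself. The generators are indexed from
   0, so those of square 1 are the e_i with i < p. *)
Definition cliff (K : fieldType) (A : galg K) (p q : nat) : Type :=
  {ffun {set 'I_(p + q)} -> A}.

Section Cliff.
Variables (K : fieldType) (A : galg K) (p q : nat).
Implicit Types (S T : {set 'I_(p + q)}).
Local Notation cl := (cliff A p q).

HB.instance Definition _ := Vector.copy cl {ffun {set 'I_(p + q)} -> A}.

(* (a (x) e_S) (b (x) e_T) = (-1)^(|S| db) a b (x) e_S e_T *)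
Definition cliff_mul : cl -> cl -> cl :=
  tconv (@symd p q) (@cl_sign K p q) (fun S => @ksign K A (odd #|S|)).
Definition cliff_one : cl := tone A set0 (@cl_sign K p q).

Let al S := @ksign K A (odd #|S|).
Let alZ S (k : K) (a : A) : al S (k *: a) = id k *: al S a.
Proof. exact: ksignZ. Qed.
Let alop S T a : al (symd S T) a = al S (al T a).
Proof. by rewrite /al odd_symd ksign_comp. Qed.
Let ale : al set0 =1 id.
Proof. by move=> a; rewrite /al cards0 ksign_false. Qed.

Lemma cliff_mulA : associative cliff_mul.
Proof.
exact: (tconvA (th := fun _ => id) (@symdA p q) (fun S => @ksignD K A _)
  (fun S => @ksignM K A _) alZ alop (@cl_signP K p q)).
Qed.

Lemma cliff_mul1 : left_id cliff_one cliff_mul.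
Proof.
exact: (tconv1 (th := fun _ => id) (@symd0 p q) _ ale (@cl_sign_neq0 K p q)
  (@cl_signP K p q)).
Qed.

Lemma cliff_mul1r : right_id cliff_one cliff_mul.
Proof.
exact: (tconv1r (th := fun _ => id) (@symd0r p q) (fun _ _ _ => erefl)
  (fun _ => erefl) (fun S => @ksignD K A _) (fun S => @ksign1 K A _) alZ
  (@cl_sign_neq0 K p q) (@cl_signP K p q)).
Qed.

Lemma cliff_mulDl : left_distributive cliff_mul +%R.
Proof. exact: tconvDl. Qed.

Lemma cliff_mulDr : right_distributive cliff_mul +%R.
Proof. exact: (tconvDr _ _ (fun S => @ksignD K A _)). Qed.

Lemma cliff_one_neq0 : cliff_one != 0.
Proof. exact: tone_neq0 (@cl_sign_neq0 K p q). Qed.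

HB.instance Definition _ := GRing.Zmodule_isNzRing.Build cl
  cliff_mulA cliff_mul1 cliff_mul1r cliff_mulDl cliff_mulDr cliff_one_neq0.

Lemma cliff_mulZl (k : K) (x y : cl) : k *: (x * y) = k *: x * y.
Proof. exact: tconvZl. Qed.

HB.instance Definition _ := GRing.Lmodule_isLalgebra.Build K cl cliff_mulZl.

Lemma cliff_mulZr (k : K) (x y : cl) : k *: (x * y) = x * (k *: y).
Proof. exact: (tconvZr (th := fun _ => id) _ _ alZ). Qed.

HB.instance Definition _ := GRing.Lalgebra_isAlgebra.Build K cl cliff_mulZr.

HB.instance Definition _ := Algebra_isFalgebra.Build K cl.

Definition cliff_single (a : A) S : cl := tsingle a S.

Definition cliff_gen (i : 'I_(p + q)) : cl := cliff_single 1 [set i].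

Definition cliff_coef S (x : cl) : A := x S.

Lemma cliff_coef_linear S : linear (cliff_coef S).
Proof. by move=> k x y; rewrite /cliff_coef !ffunE. Qed.

HB.instance Definition _ S :=
  GRing.isLinear.Build K cl A _ (cliff_coef S) (cliff_coef_linear S).

(* The degree of a (x) e_S is da + |S|. *)
Definition cliff_gr (i : bool) : {vspace cl} :=
  (\bigcap_S (linfun (cliff_coef S) @^-1: gr A (i (+) odd #|S|)))%VS.

Lemma cliff_grP i (x : cl) :
  reflect (forall S, x S \in gr A (i (+) odd #|S|)) (x \in cliff_gr i).
Proof.
apply: (iffP idP) => [|xi].
  rewrite memvE => /subv_bigcapP xi S.
  by have := xi S isT; rewrite -memvE -memv_preim lfunE.
rewrite memvE; apply/subv_bigcapP => S _.
by rewrite -memvE -memv_preim lfunE; apply: xi.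
Qed.

Lemma cliff_grading : is_grading cliff_gr.
Proof.
split.
  apply/eqP; rewrite eqEsubv subvf; apply/subvP => x _.
  pose c i : cl := [ffun S : {set 'I_(p + q)} => gcomp (i (+) odd #|S|) (x S)].
  have -> : x = c false + c true.
    apply/ffunP => S; rewrite !ffunE.
    by case: (odd _); rewrite /= ?gcomp_sum // addrC gcomp_sum.
  by apply: memv_add; apply/cliff_grP => S; rewrite ffunE gcomp_gr.
apply/eqP; rewrite -subv0; apply/subvP => x; rewrite memv_cap memv0.
case/andP => /cliff_grP x0 /cliff_grP x1; apply/eqP/ffunP => S; rewrite !ffunE.
apply/eqP; rewrite -memv0 -(gr_disj A (odd #|S|)) memv_cap.
by have := x0 S; have := x1 S; rewrite /= => -> ->.
Qed.

Lemma cliff_gr1 : 1 \in cliff_gr false.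
Proof.
apply/cliff_grP => S; rewrite ffunE; case: eqP => [->|_]; last exact: mem0v.
by rewrite cards0 memvZ ?gr1.
Qed.

Lemma cliff_grM i j (x y : cl) :
  x \in cliff_gr i -> y \in cliff_gr j -> x * y \in cliff_gr (i (+) j).
Proof.
move=> /cliff_grP xi /cliff_grP yj; apply/cliff_grP => U; rewrite ffunE.
apply: memv_suml => S _; apply: memv_suml => T /eqP <-; apply: memvZ.
rewrite odd_symd addbACA; apply: grM; first exact: xi.
exact/ksign_gr/yj.
Qed.

Definition galg_cliff : galg K := GAlg cliff_grading cliff_gr1 cliff_grM.

Lemma cliff_singleM (a b : A) j S T : b \in gr A j ->
  cliff_single a S * cliff_single b T =
  cl_sign K S T *: cliff_single ((-1) ^+ (j && odd #|S|) *: (a * b)) (symd S T).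
Proof.
move=> bj; rewrite [LHS](tconv_single _ _ (fun S => @ksignD K A _)).
rewrite (ksignE _ bj) -scalerAr; apply/ffunP => U; rewrite !ffunE.
by case: ifP; rewrite ?scaler0.
Qed.

Lemma cliff_gen_sq i : cliff_gen i * cliff_gen i = if (i < p)%N then 1 else -1.
Proof.
rewrite (cliff_singleM _ _ _ (gr1 A)) /= scale1r mulr1 /cl_sign !big_set1.
rewrite /cl_pair ltnn eqxx /=.
have -> : symd [set i] [set i] = set0.
  by apply/setP => k; rewrite in_symd addbb inE.
have -> : cliff_single 1 set0 = 1.
  by apply/ffunP => S; rewrite !ffunE cl_sign0 invr1 scale1r.
by rewrite leqNgt; case: (i < p)%N; rewrite /= ?scale1r ?scaleN1r.
Qed.

Lemma cliff_gen_anticomm i j : i != j ->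
  cliff_gen i * cliff_gen j = - (cliff_gen j * cliff_gen i).
Proof.
move=> ij; rewrite !(cliff_singleM _ _ _ (gr1 A)) /= !scale1r !mulr1 /cl_sign.
rewrite !big_set1 /cl_pair [j == i]eq_sym (negPf ij) /= !orbF.
have -> : symd [set j] [set i] = symd [set i] [set j].
  by apply/setP => k; rewrite !in_symd addbC.
by case: ltngtP ij => [||/val_inj ->]; rewrite ?eqxx // !(scaleN1r, scale1r) ?opprK.
Qed.

(* e_S is the product of its generators in increasing order. *)
Lemma cliff_single_gen i S : i \notin S -> (forall j, j \in S -> (i < j)%N) ->
  cliff_single 1 (i |: S) = cliff_gen i * cliff_single 1 S.
Proof.
move=> iS iltS; rewrite (cliff_singleM _ _ _ (gr1 A)) /= scale1r mulr1.
rewrite /cl_sign big_set1 big1 => [|j jS]; last first.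
  rewrite /cl_pair ltnNge ltnW ?iltS //=; case: eqP => // ij.
  by move: iS; rewrite ij jS.
rewrite scale1r; congr cliff_single; apply/setP => j; rewrite in_symd !inE.
by case: eqP => // ->; rewrite (negPf iS).
Qed.

End Cliff.

Section MagCliff.
Variables (R : realType) (G : magnetic) (A : magalg R G) (p q : nat).
Local Notation cl := (galg_cliff A p q).

(* g (a (x) b) = g a (x) K^phi(g) b, where K fixes every e_S. *)
Definition cliff_act (g : G) (x : cl) : cl := [ffun S : {set 'I_(p + q)} => ma_act g (x S)].

Lemma ma_act0 g : ma_act g (0 : A) = 0.
Proof. exact: tconv_al0 (@ma_actD R G A) g. Qed.

Lemma ma_act_sum g (J : Type) (r : seq J) (P : pred J) (F : J -> A) :
  ma_act g (\sum_(j <- r | P j) F j) = \sum_(j <- r | P j) ma_act g (F j).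
Proof. exact: tconv_al_sum (@ma_actD R G A) _ _ _ _ _. Qed.

Lemma ma_act_ksign g e (a : A) : ksign e (ma_act g a) = ma_act g (ksign e a).
Proof.
elim/gr_ind: a => [a b IHa IHb|i a ai].
  by rewrite ksignD ma_actD ksignD IHa IHb -ma_actD.
by rewrite (ksignE _ ai) (ksignE _ (ma_act_gr g ai)) ma_actZ conjb_sign.
Qed.

Lemma conjb_cl_sign b (S T : {set 'I_(p + q)}) :
  conjb b (cl_sign R[i] S T) = cl_sign R[i] S T.
Proof.
case: b => //; rewrite /conjb /cl_sign rmorph_prod; apply: eq_bigr => i _.
rewrite rmorph_prod; apply: eq_bigr => j _; rewrite /cl_pair.
by case: ifP; rewrite ?rmorphN rmorph1.
Qed.

Lemma cliff_actD g : {morph cliff_act g : x y / x + y}.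
Proof. by move=> x y; apply/ffunP => S; rewrite !ffunE ma_actD. Qed.

Lemma cliff_actM g : {morph cliff_act g : x y / x * y}.
Proof.
move=> x y; apply/ffunP => U; rewrite !ffunE ma_act_sum; apply: eq_bigr => S _.
rewrite ma_act_sum; apply: eq_bigr => T _.
by rewrite ma_actZ conjb_cl_sign ma_actM !ffunE ma_act_ksign.
Qed.

Lemma cliff_act1 g : cliff_act g 1 = 1.
Proof.
apply/ffunP => S; rewrite !ffunE; case: eqP => _; last exact: ma_act0.
by rewrite cl_sign0 invr1 ma_actZ conjb1 ma_act1.
Qed.

Lemma cliff_actZ g z x : cliff_act g (z *: x) = conjb (phi g) z *: cliff_act g x.
Proof. by apply/ffunP => S; rewrite !ffunE ma_actZ. Qed.

Lemma cliff_act_id : cliff_act 1%g =1 id.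
Proof. by move=> x; apply/ffunP => S; rewrite !ffunE ma_act_id. Qed.

Lemma cliff_act_mulg g h x : cliff_act (g * h)%g x = cliff_act g (cliff_act h x).
Proof. by apply/ffunP => S; rewrite !ffunE ma_act_mulg. Qed.

Lemma cliff_act_gr g i x : x \in gr cl i -> cliff_act g x \in gr cl i.
Proof.
by move=> /cliff_grP xi; apply/cliff_grP => S; rewrite ffunE ma_act_gr.
Qed.

Definition magcliff : magalg R G :=
  MagAlg cliff_actD cliff_actM cliff_act1 cliff_actZ cliff_act_id
    cliff_act_mulg cliff_act_gr.

End MagCliff.

Section Examples.
Variables (R : realType) (G : magnetic).

Definition conjC_act (g : G) (z : ungraded R[i]^o) : ungraded R[i]^o :=
  conjb (phi g) z.

Lemma conjC_act_id : conjC_act 1%g =1 id.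
Proof. by move=> z; rewrite /conjC_act phi1. Qed.

Lemma conjC_act_mulg g h z :
  conjC_act (g * h)%g z = conjC_act g (conjC_act h z).
Proof. by rewrite /conjC_act phiM conjb_addb. Qed.

Lemma conjC_act_gr g i z :
  z \in gr (ungraded R[i]^o) i -> conjC_act g z \in gr (ungraded R[i]^o) i.
Proof.
case: i => /=; rewrite ?memvf // !memv0 => /eqP ->.
by rewrite /conjC_act /conjb; case: (phi g); rewrite ?rmorph0.
Qed.

Definition magC : magalg R G :=
  @MagAlg R G (ungraded R[i]^o) conjC_act (fun g => @conjbD R (phi g))
    (fun g => @conjbM R (phi g)) (fun g => conjb1 R (phi g))
    (fun g => @conjbM R (phi g)) conjC_act_id conjC_act_mulg conjC_act_gr.

(* C^{p,q}_C = C^{p,q}_R (x)_R C with the action id (x) K^phi(g) *)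
Definition cliffC (p q : nat) : magalg R G := magcliff magC p q.

Definition mat2 : galg R[i] := ungraded 'M[R[i]]_2.

Definition conjM_act (g : G) (X : mat2) : mat2 := map_mx (conjb (phi g)) X.

Lemma map_conjbM b (X Y : 'M[R[i]]_2) :
  map_mx (conjb b) (X * Y) = map_mx (conjb b) X * map_mx (conjb b) Y.
Proof.
apply/matrixP => i j; rewrite !mxE; case: b; rewrite /conjb ?rmorph_sum.
  by apply: eq_bigr => k _; rewrite !mxE rmorphM.
by apply: eq_bigr => k _; rewrite !mxE.
Qed.

Lemma map_conjb1 b : map_mx (conjb b) (1 : 'M[R[i]]_2) = 1.
Proof.
apply/matrixP => i j; rewrite !mxE.
by case: b; case: (i == j); rewrite /conjb ?rmorph1 ?rmorph0.
Qed.

Lemma map_conjbD b (X Y : 'M[R[i]]_2) :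
  map_mx (conjb b) (X + Y) = map_mx (conjb b) X + map_mx (conjb b) Y.
Proof. by apply/matrixP => i j; rewrite !mxE conjbD. Qed.

Lemma map_conjbZ b z (X : 'M[R[i]]_2) :
  map_mx (conjb b) (z *: X) = conjb b z *: map_mx (conjb b) X.
Proof. by apply/matrixP => i j; rewrite !mxE conjbM. Qed.

Lemma conjM_act_id : conjM_act 1%g =1 id.
Proof. by move=> X; apply/matrixP => i j; rewrite mxE phi1. Qed.

Lemma conjM_act_mulg g h X :
  conjM_act (g * h)%g X = conjM_act g (conjM_act h X).
Proof. by apply/matrixP => i j; rewrite !mxE phiM conjb_addb. Qed.

Lemma ungraded_act_gr (A : falgType R[i]) (f : A -> A) i (a : ungraded A) :
  {morph f : a b / a + b} -> a \in gr (ungraded A) i -> f a \in gr (ungraded A) i.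
Proof.
move=> fD; case: i => /=; rewrite ?memvf // !memv0 => /eqP ->.
by apply/eqP/(addrI (f 0)); rewrite -fD !addr0.
Qed.

Definition magM2 : magalg R G :=
  @MagAlg R G mat2 conjM_act (fun g => map_conjbD (phi g))
    (fun g => map_conjbM (phi g)) (fun g => map_conjb1 (phi g))
    (fun g => map_conjbZ (phi g)) conjM_act_id conjM_act_mulg
    (fun g i a => ungraded_act_gr (map_conjbD (phi g))).

End Examples.

Section AdJK.
Variable R : realType.

Definition matJ : 'M[R[i]]_2 :=
  \matrix_(i < 2, j < 2) (if (i == 0) && (j == 1) then -1
                          else if (i == 1) && (j == 0) then 1 else 0).

Definition adJK (b : magZ2) (X : mat2 R) : mat2 R :=
  if b then matJ * map_mx (@conjc R) X * matJ^-1 else X.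

Lemma matJ_sq : matJ * matJ = -1.
Proof.
apply/matrixP => i j; rewrite !mxE !big_ord_recl big_ord0 !mxE.
by case: i => [[|[|//]] ?]; case: j => [[|[|//]] ?] /=;
  rewrite ?mulr0 ?mul0r ?mulr1 ?mul1r ?addr0 ?add0r ?oppr0.
Qed.

Lemma matJ_unit : matJ \is a GRing.unit.
Proof.
apply/unitrP; exists (- matJ).
by rewrite mulrN mulNr matJ_sq opprK.
Qed.

Lemma conj_matJ : map_mx (@conjc R) matJ = matJ.
Proof.
apply/matrixP => i j; rewrite !mxE; case: ifP => _; first by rewrite rmorphN rmorph1.
by case: ifP => _; rewrite ?rmorph1 ?rmorph0.
Qed.

Lemma matJV : matJ^-1 = - matJ.
Proof.
by apply: (mulrI matJ_unit); rewrite mulrV ?matJ_unit // mulrN matJ_sq opprK.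
Qed.

Lemma adJKD b : {morph adJK b : X Y / X + Y}.
Proof.
by case: b => // X Y; rewrite /adJK [map_mx _ _](map_conjbD true) mulrDr mulrDl.
Qed.

Lemma adJKM b : {morph adJK b : X Y / X * Y}.
Proof.
case: b => // X Y; rewrite /adJK [map_mx _ _](map_conjbM true) !mulrA.
by rewrite mulrVK ?matJ_unit.
Qed.

Lemma adJK1 b : adJK b 1 = 1.
Proof.
case: b => //; rewrite /adJK [map_mx _ _](map_conjb1 _ true) mulr1.
by rewrite mulrV ?matJ_unit.
Qed.

Lemma adJKZ (b : magZ2) z X : adJK b (z *: X) = conjb (phi b) z *: adJK b X.
Proof.
case: b => //; rewrite /adJK [map_mx _ _](map_conjbZ true).
by rewrite -scalerAr -scalerAl.
Qed.

Lemma adJK_id : adJK 1%g =1 id.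
Proof. by []. Qed.

Lemma adJK_mulg (b c : magZ2) X : adJK (b * c)%g X = adJK b (adJK c X).
Proof.
case: b c => [] [] //; rewrite /adJK matJV.
rewrite [map_mx _ (_ * _)](map_conjbM true) [map_mx _ (_ * _)](map_conjbM true).
rewrite /conjb [in RHS]raddfN /= conj_matJ !mulrN !mulNr opprK !mulrA matJ_sq.
rewrite -!mulrA matJ_sq mulrN1 mulN1r opprK; apply/matrixP => i j.
by rewrite !mxE conjcK.
Qed.

Definition magM2J : magalg R magZ2 :=
  @MagAlg R magZ2 (mat2 R) adJK adJKD adJKM adJK1 adJKZ adJK_id adJK_mulg
    (fun g i a => ungraded_act_gr (adJKD g)).

End AdJK.

(* A finite-dimensional Z/2-graded vector space with a family of operators,
   not required to be linear. *)
Record gspace (K : fieldType) (X : Type) := GSpace {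
  gs_sort :> vectType K;
  gs_gr : bool -> {vspace gs_sort};
  gs_grading : is_grading gs_gr;
  gs_op : X -> gs_sort -> gs_sort }.

Arguments gs_gr {K X} g i.
Arguments gs_op {K X} g x v.

Section DirectSum.
Variables (K : fieldType) (X : Type) (E F : gspace K X).

Definition gsum_gr (i : bool) : {vspace (E * F)%type} :=
  (linfun fst @^-1: gs_gr E i :&: linfun snd @^-1: gs_gr F i)%VS.

Lemma gsum_grP i (v : (E * F)%type) :
  (v \in gsum_gr i) = (v.1 \in gs_gr E i) && (v.2 \in gs_gr F i).
Proof. by rewrite memv_cap -!memv_preim !lfunE. Qed.

Lemma gsum_grading : is_grading gsum_gr.
Proof.
have [sE iE] := gs_grading E; have [sF iF] := gs_grading F; split.
  apply/eqP; rewrite eqEsubv subvf; apply/subvP => -[v w] _.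
  have /memv_addP[v0 v0E [v1 v1E ->]] : v \in (gs_gr E false + gs_gr E true)%VS.
    by rewrite sE memvf.
  have /memv_addP[w0 w0F [w1 w1F ->]] : w \in (gs_gr F false + gs_gr F true)%VS.
    by rewrite sF memvf.
  rewrite -[X in X \in _]/((v0, w0) + (v1, w1)).
  by apply: memv_add; rewrite gsum_grP /= ?v0E ?w0F ?v1E ?w1F.
apply/eqP; rewrite -subv0; apply/subvP => -[v w].
rewrite memv_cap !gsum_grP /= => /andP[/andP[v0 w0] /andP[v1 w1]].
have : v \in (gs_gr E false :&: gs_gr E true)%VS by rewrite memv_cap v0.
have : w \in (gs_gr F false :&: gs_gr F true)%VS by rewrite memv_cap w0.
by rewrite iE iF !memv0 => /eqP -> /eqP ->.
Qed.

Definition gsum : gspace K X :=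
  @GSpace K X (E * F)%type gsum_gr gsum_grading
    (fun x v => (gs_op E x v.1, gs_op F x v.2)).

End DirectSum.

(* The graded modules of some kind, as the gspaces satisfying [is_mod]. *)
Record modtheory (K : fieldType) := ModTheory {
  mt_op : Type;
  is_mod : gspace K mt_op -> Prop;
  is_mod_sum : forall E F, is_mod E -> is_mod F -> is_mod (gsum E F) }.

(* The category E^R for R = A_rho[G]. Since [cm_scale] makes the scalars of A
   act as those of E, an element |a, g| acts antilinearly if phi g = 1. *)
Section CrossedModules.
Variables (R : realType) (G : magnetic) (A : magalg R G) (rho : cocycle R G).
Local Notation B := (crossed A rho).

Record is_crossed_mod (E : gspace R[i] B) : Prop := IsCrossedMod {
  cm_addl : forall x y v, gs_op E (x + y) v = gs_op E x v + gs_op E y v;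
  cm_addr : forall x u v, gs_op E x (u + v) = gs_op E x u + gs_op E x v;
  cm_one : forall v, gs_op E 1 v = v;
  cm_mul : forall x y v, gs_op E (x * y) v = gs_op E x (gs_op E y v);
  cm_scale : forall (z : R[i]) v, gs_op E (z *: 1) v = z *: v;
  cm_gr : forall i j a g v, a \in gr A i -> v \in gs_gr E j ->
    gs_op E (crossed_single rho a g) v \in gs_gr E (i (+) j) }.

Lemma crossed_mod_sum E F :
  is_crossed_mod E -> is_crossed_mod F -> is_crossed_mod (gsum E F).
Proof.
move=> mE mF; split.
- by move=> x y [v w]; congr pair; rewrite cm_addl.
- by move=> x [v w] [v' w']; congr pair; rewrite cm_addr.
- by move=> [v w]; congr pair; rewrite cm_one.
- by move=> x y [v w]; congr pair; rewrite cm_mul.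
- by move=> z [v w]; congr pair; rewrite cm_scale.
- move=> i j a g [v w] ai; rewrite /gs_gr /= !gsum_grP /= => /andP[vj wj].
  by rewrite !cm_gr.
Qed.

Definition crossed_modules : modtheory R[i] :=
  ModTheory crossed_mod_sum.

End CrossedModules.

(* The G-equivariant graded A-modules: [inl a] is the action of a in A, [inr g]
   that of g in G. *)
Section EquivariantModules.
Variables (R : realType) (G : magnetic) (A : magalg R G).

Record is_equivariant_mod (E : gspace R[i] (A + G)) : Prop := IsEquivariantMod {
  em_addl : forall a b v,
    gs_op E (inl (a + b)) v = gs_op E (inl a) v + gs_op E (inl b) v;
  em_addr : forall a u v,
    gs_op E (inl a) (u + v) = gs_op E (inl a) u + gs_op E (inl a) v;
  em_one : forall v, gs_op E (inl 1) v = v;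
  em_mul : forall a b v,
    gs_op E (inl (a * b)) v = gs_op E (inl a) (gs_op E (inl b) v);
  em_scale : forall (z : R[i]) v, gs_op E (inl (z *: 1)) v = z *: v;
  em_gr : forall i j a v, a \in gr A i -> v \in gs_gr E j ->
    gs_op E (inl a) v \in gs_gr E (i (+) j);
  em_actD : forall g u v,
    gs_op E (inr g) (u + v) = gs_op E (inr g) u + gs_op E (inr g) v;
  em_act_id : forall v, gs_op E (inr 1%g) v = v;
  em_act_mulg : forall g h v,
    gs_op E (inr (g * h)%g) v = gs_op E (inr g) (gs_op E (inr h) v);
  em_act_gr : forall g j v, v \in gs_gr E j -> gs_op E (inr g) v \in gs_gr E j;
  em_act_mul : forall g a v, gs_op E (inr g) (gs_op E (inl a) v) =
    gs_op E (inl (ma_act g a)) (gs_op E (inr g) v) }.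

Lemma equivariant_mod_sum E F : is_equivariant_mod E -> is_equivariant_mod F ->
  is_equivariant_mod (gsum E F).
Proof.
move=> mE mF; split.
- by move=> a b [v w]; congr pair; rewrite em_addl.
- by move=> a [v w] [v' w']; congr pair; rewrite em_addr.
- by move=> [v w]; congr pair; rewrite em_one.
- by move=> a b [v w]; congr pair; rewrite em_mul.
- by move=> z [v w]; congr pair; rewrite em_scale.
- move=> i j a [v w] ai; rewrite /gs_gr /= !gsum_grP /= => /andP[vj wj].
  by rewrite !em_gr.
- by move=> g [v w] [v' w']; congr pair; rewrite em_actD.
- by move=> [v w]; congr pair; rewrite em_act_id.
- by move=> g h [v w]; congr pair; rewrite em_act_mulg.
- move=> g j [v w]; rewrite /gs_gr /= !gsum_grP /= => /andP[vj wj].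
  by rewrite !em_act_gr.
- by move=> g a [v w]; congr pair; rewrite em_act_mul.
Qed.

Definition equivariant_modules : modtheory R[i] :=
  ModTheory equivariant_mod_sum.

End EquivariantModules.

Section Maps.
Variables (K : fieldType) (X : Type).

Definition mod_map (E F : gspace K X) (f : 'Hom(E, F)) : Prop :=
  forall x v, f (gs_op E x v) = gs_op F x (f v).

Definition mod_iso (E F : gspace K X) (f : 'Hom(E, F)) : Prop :=
  mod_map f /\ bijective f.

Definition degree0 (E F : gspace K X) (f : 'Hom(E, F)) : Prop :=
  forall i v, v \in gs_gr E i -> f v \in gs_gr F i.

Definition hom_sum_fun (E F E' F' : gspace K X) (f : 'Hom(E, F))
  (f' : 'Hom(E', F')) (v : gsum E E') : gsum F F' := (f v.1, f' v.2).

Lemma hom_sum_linear (E F E' F' : gspace K X) (f : 'Hom(E, F))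
  (f' : 'Hom(E', F')) : linear (hom_sum_fun f f').
Proof.
by move=> k [v v'] [w w']; congr pair; rewrite /= linearP.
Qed.

HB.instance Definition _ E F E' F' f f' :=
  GRing.isLinear.Build K (gsum E E') (gsum F F') _ (@hom_sum_fun E F E' F' f f')
    (hom_sum_linear f f').

Definition hom_sum (E F E' F' : gspace K X) (f : 'Hom(E, F))
  (f' : 'Hom(E', F')) : 'Hom(gsum E E', gsum F F') := linfun (hom_sum_fun f f').

Lemma mod_iso_sum (E F E' F' : gspace K X) (f : 'Hom(E, F))
  (f' : 'Hom(E', F')) : mod_iso f -> mod_iso f' -> mod_iso (hom_sum f f').
Proof.
move=> [fm [g fK gK]] [fm' [g' fK' gK']]; split.
  by move=> x [v v']; rewrite !lfunE /= /hom_sum_fun /= fm fm'.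
exists (fun w => (g w.1, g' w.2)) => -[v v'].
  by rewrite lfunE /= fK fK'.
by rewrite lfunE /= /hom_sum_fun /= gK gK'.
Qed.

End Maps.

Record mobj (K : fieldType) (M : modtheory K) := MObj {
  mo_gspace :> gspace K (mt_op M);
  moP : is_mod mo_gspace }.

Definition mobj_sum (K : fieldType) (M : modtheory K) (E F : mobj M) : mobj M :=
  MObj (is_mod_sum (moP E) (moP F)).

Record triple (K : fieldType) (M : modtheory K) := Triple {
  tE : mobj M;
  tF : mobj M;
  ts : 'Hom(tE, tF);
  tsP : mod_iso ts }.

Definition triple_sum (K : fieldType) (M : modtheory K) (t u : triple M) :
    triple M :=
  @Triple K M (mobj_sum (tE t) (tE u)) (mobj_sum (tF t) (tF u))
    (hom_sum (ts t) (ts u)) (mod_iso_sum (tsP t) (tsP u)).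

Definition elementary (K : fieldType) (M : modtheory K) (t : triple M) : Prop :=
  degree0 (ts t).

Section KTheory.
Local Open Scope classical_set_scope.
Variables (R : realType) (M : modtheory R[i]).

(* Continuity on [0, 1] for the topology of the finite-dimensional space
   Hom(V, W): all the matrix coefficients l (s t v) are continuous. *)
Definition continuous_path (V W : vectType R[i]) (s : R -> 'Hom(V, W)) : Prop :=
  forall (v : V) (l : 'Hom(W, R[i]^o)),
    {within `[0, 1], continuous (fun t : R => complex.Re (l (s t v)) : R)}
    /\ {within `[0, 1], continuous (fun t : R => complex.Im (l (s t v)) : R)}.

Definition homotopic (t0 t1 : triple M) : Prop :=
  exists (f : 'Hom(tE t0, tE t1)) (g : 'Hom(tF t0, tF t1))
         (s : R -> 'Hom(tE t0, tF t0)),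
    [/\ mod_iso f /\ degree0 f,
        mod_iso g /\ degree0 g,
        continuous_path s,
        forall t, 0 <= t <= 1 -> mod_iso (s t)
      & s 0 = ts t0 /\ s 1 = (g^-1 \o (ts t1 \o f))%VF].

(* The abelian group generated by the triples, with the relations below:
   formal expressions modulo the least congruence. The group is large
   (triples involve arbitrary vector spaces), and the universe constraints of
   the library do not allow a choiceType, hence a zmodType, on it. *)
Inductive kexpr :=
  | KGen of triple M
  | KZero
  | KOpp of kexpr
  | KAdd of kexpr & kexpr.

Inductive keq : kexpr -> kexpr -> Prop :=
  | keq_refl x : keq x x
  | keq_sym x y : keq x y -> keq y x
  | keq_trans x y z : keq x y -> keq y z -> keq x z
  | keq_opp x y : keq x y -> keq (KOpp x) (KOpp y)
  | keq_add x x' y y' : keq x x' -> keq y y' -> keq (KAdd x y) (KAdd x' y')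
  | keq_addA x y z : keq (KAdd x (KAdd y z)) (KAdd (KAdd x y) z)
  | keq_addC x y : keq (KAdd x y) (KAdd y x)
  | keq_add0 x : keq (KAdd KZero x) x
  | keq_addN x : keq (KAdd (KOpp x) x) KZero
  | keq_sum t u : keq (KGen (triple_sum t u)) (KAdd (KGen t) (KGen u))
  | keq_homotopic t u : homotopic t u -> keq (KGen t) (KGen u)
  | keq_elementary t : elementary t -> keq (KGen t) KZero.

(* The quotient, as the type of equivalence classes. *)
Definition Kgroup := {P : kexpr -> Prop | exists x, P = keq x}.

Definition kclass (x : kexpr) : Kgroup := exist _ (keq x) (ex_intro _ x erefl).

Definition krepr (a : Kgroup) : kexpr := sval (cid (svalP a)).

Definition kadd (a b : Kgroup) : Kgroup := kclass (KAdd (krepr a) (krepr b)).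
Definition kopp (a : Kgroup) : Kgroup := kclass (KOpp (krepr a)).
Definition kzero : Kgroup := kclass KZero.

Lemma kreprK a : kclass (krepr a) = a.
Proof.
case: a => P aP; apply: eq_exist; rewrite /krepr.
by case: cid => x /= /esym.
Qed.

Lemma kclassP x y : kclass x = kclass y <-> keq x y.
Proof.
split=> [/(congr1 sval) /= xy|xy]; first by rewrite xy; apply: keq_refl.
apply: eq_exist => /=; apply/funext => z; apply/propext.
by split; apply: keq_trans => //; apply: keq_sym.
Qed.

Lemma krepr_class x : keq (krepr (kclass x)) x.
Proof. by apply/kclassP; rewrite kreprK. Qed.

Lemma kaddE x y : kadd (kclass x) (kclass y) = kclass (KAdd x y).
Proof. by apply/kclassP; apply: keq_add; apply: krepr_class. Qed.

Lemma koppE x : kopp (kclass x) = kclass (KOpp x).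
Proof. by apply/kclassP; apply: keq_opp; apply: krepr_class. Qed.

Lemma kaddA : associative kadd.
Proof.
move=> a b c; rewrite -(kreprK a) -(kreprK b) -(kreprK c) !kaddE.
by apply/kclassP; apply: keq_addA.
Qed.

Lemma kaddC : commutative kadd.
Proof.
move=> a b; rewrite -(kreprK a) -(kreprK b) !kaddE.
by apply/kclassP; apply: keq_addC.
Qed.

Lemma kadd0 : left_id kzero kadd.
Proof.
by move=> a; rewrite -(kreprK a) kaddE; apply/kclassP; apply: keq_add0.
Qed.

Lemma kaddN : left_inverse kzero kopp kadd.
Proof.
move=> a; rewrite -(kreprK a) koppE kaddE.
by apply/kclassP; apply: keq_addN.
Qed.

End KTheory.

Definition Kisomorphic (R : realType) (M N : modtheory R[i]) : Prop :=
  exists f : Kgroup M -> Kgroup N,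
    bijective f /\ {morph f : a b / kadd a b >-> kadd a b}.

(* Main.v *)
Require Import Defs.
From mathcomp Require Import all_boot all_order all_algebra all_fingroup.
From mathcomp Require Import all_solvable all_field complex.
From mathcomp Require Import boolp classical_sets set_interval reals topology.
From mathcomp Require Import normedtype trigo finset.
From HB Require Import structures.

(** The isomorphisms of crossed products come from a change of basis: J is real
   and J J = -1, so that (a, g) |-> |a J^phi(g), g| replaces the action Ad_JK by
   entrywise conjugation, at the price of the cocycle sigma ([crossed_untwist]).

   For the K-groups, everything happens at the level of modules: an equivalence
   between the categories of all module maps which is linear on maps and
   respects degree zero induces an isomorphism of the groups of triples
   ([kequivalence]). So it suffices to compare two kinds of modules. A module
   over A^{p,q} with a rho-twisted action of G amounts to a graded A-module with
   p + q anticommuting odd operators of square 1 or -1, the generators, and with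
   semilinear operators T(g) such that T(g) T(h) = rho(g, h) T(gh)
   ([equivariant_cl], [crossed_cl], [cliff_universal]).

   Let f and f' be two of the generators of square -1. Then f f' is even, it
   squares to -1 and it commutes with A and with the other generators. Hence the
   module is the sum of the eigenspaces of f f' for i and -i; the operator f,
   which anticommutes with f f', exchanges them. So the module is determined by
   the first one, on which A and the other generators act. An antilinear T(g)
   also exchanges the eigenspaces, and therefore T'(g) = f T(g) acts on the
   first. Its parity is opposite to that of T(g). If the antilinear T(g) have
   parity k and commute with odd elements up to the sign rule, then for g and h
   acting antilinearly
     T'(g) T'(h) = (-1)^k f f T(g) T(h) = - (-1)^k rho(g, h) T'(gh).
   This removes two generators ([cl_remove_two]). Doing it twice removes four
   generators and restores the parity of the operators; the two passes, with
   k = 0 and k = 1, contribute the signs -1 and 1, so that the cocycle changes by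
   (-1)^(phi(g) phi(h)), which is phi^* sigma. *)

Set Implicit Arguments.
Unset Strict Implicit.
Unset Printing Implicit Defensive.

Import Order.TTheory GRing.Theory Num.Theory numFieldNormedType.Exports.

Local Open Scope ring_scope.

(** * Functoriality of the K-groups *)

Section LinearMaps.
Variables (K : fieldType) (U V : vectType K).

Lemma linfunE_lin (h : U -> V) : linear h -> forall u, linfun h u = h u.
Proof.
move=> hlin u.
pose hL := GRing.isLinear.Build K U V *:%R h hlin.
pose hh : {linear U -> V} := HB.pack h hL.
exact: (lfunE hh u).
Qed.

Lemma bij_lfunVK (f : 'Hom(U, V)) : bijective f -> cancel f f^-1%VF.
Proof.
move=> fbij; apply/lker0_lfunK; rewrite -subv0; apply/subvP => u.
by rewrite memv_ker memv0 -(inj_eq (bij_inj fbij)) linear0.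
Qed.

Lemma bij_lfunKV (f : 'Hom(U, V)) : bijective f -> cancel f^-1%VF f.
Proof.
move=> fbij v; have [g fK gK] := fbij.
by rewrite -[in RHS](gK v) -[in LHS](gK v) bij_lfunVK.
Qed.

End LinearMaps.

Section ModMaps.
Variables (K : fieldType) (X : Type).
Implicit Types E F G : gspace K X.

Lemma mod_map_comp E F G (f : 'Hom(E, F)) (g : 'Hom(F, G)) :
  mod_map f -> mod_map g -> mod_map (g \o f)%VF.
Proof. by move=> mf mg x v; rewrite !lfunE /= mf mg. Qed.

Lemma mod_iso_inv E F (f : 'Hom(E, F)) : mod_iso f -> mod_iso (f^-1)%VF.
Proof.
move=> [mf bf]; split; last by exists f; [exact: bij_lfunKV | exact: bij_lfunVK].
by move=> x v; apply: (bij_inj bf); rewrite mf !bij_lfunKV.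
Qed.

Lemma mod_iso_cancel E F (f : 'Hom(E, F)) (g : 'Hom(F, E)) :
  mod_map f -> (g \o f = \1)%VF -> (f \o g = \1)%VF -> mod_iso f.
Proof.
move=> mf gf fg; split=> //; exists g => v.
  by rewrite -[RHS](id_lfunE v) -gf lfunE.
by rewrite -[RHS](id_lfunE v) -fg lfunE.
Qed.

End ModMaps.

Section Continuity.
Variable R : realType.
Local Open Scope classical_set_scope.

Lemma continuous_path_cst (V W : vectType R[i]) (s : 'Hom(V, W)) :
  continuous_path (fun _ => s).
Proof. by move=> v l; split => x; exact: cvg_cst. Qed.

Let cpath (f : R -> R[i]) :=
  {within `[0, 1], continuous (fun t : R => complex.Re (f t) : R)}
  /\ {within `[0, 1], continuous (fun t : R => complex.Im (f t) : R)}.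

Let cpathZ (c : R[i]) f : cpath f -> cpath (fun t => c * f t).
Proof.
move=> [rf jf].
have h : forall (a b : R) (g k : R -> R),
    {within `[0, 1], continuous g} -> {within `[0, 1], continuous k} ->
    {within `[0, 1], continuous (fun t => a * g t + b * k t)}.
  move=> a b g k cg ck x; apply: cvgD.
    by apply: cvgM; [exact: cvg_cst | exact: cg].
  by apply: cvgM; [exact: cvg_cst | exact: ck].
split.
  rewrite (_ : (fun _ => _) = fun t : R => complex.Re c * complex.Re (f t)
      + (- complex.Im c) * complex.Im (f t)); first exact: h.
  by apply/funext => t; case: (c) (f t) => [a b] [x y]; rewrite /= mulNr.
rewrite (_ : (fun _ => _) = fun t : R => complex.Im c * complex.Re (f t)
    + complex.Re c * complex.Im (f t)); first exact: h.
by apply/funext => t; case: (c) (f t) => [a b] [x y]; rewrite /= addrC.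
Qed.

Let cpath_sum (I : Type) (r : seq I) (f : I -> R -> R[i]) :
  (forall i, cpath (f i)) -> cpath (fun t => \sum_(i <- r) f i t).
Proof.
move=> cf; elim: r => [|i r [IHr IHj]].
  have -> : (fun t => \sum_(i <- [::]) f i t) = fun=> 0.
    by apply/funext => t; rewrite big_nil.
  by split => x; exact: cvg_cst.
have -> : (fun t => \sum_(j <- i :: r) f j t) =
    fun t => f i t + \sum_(j <- r) f j t.
  by apply/funext => t; rewrite big_cons.
have [cr cj] := cf i; split.
  rewrite (_ : (fun _ => _) = fun t : R => complex.Re (f i t)
      + complex.Re (\sum_(j <- r) f j t)).
    by move=> x; apply: cvgD; [exact: cr | exact: IHr].
  by apply/funext => t; rewrite raddfD.
rewrite (_ : (fun _ => _) = fun t : R => complex.Im (f i t)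
    + complex.Im (\sum_(j <- r) f j t)).
  by move=> x; apply: cvgD; [exact: cj | exact: IHj].
by apply/funext => t; rewrite raddfD.
Qed.

(** A linear map between spaces of homomorphisms is continuous, since each
   matrix coefficient of [Phi s] is a linear combination of those of [s]. *)
Lemma continuous_path_linear (V W V' W' : vectType R[i])
    (Phi : 'Hom(V, W) -> 'Hom(V', W')) (s : R -> 'Hom(V, W)) :
  linear Phi -> continuous_path s -> continuous_path (fun t => Phi (s t)).
Proof.
move=> Plin cs v l.
pose PL := GRing.isLinear.Build R[i] _ _ *:%R Phi Plin.
pose P : {linear 'Hom(V, W) -> 'Hom(V', W')} := HB.pack Phi PL.
pose eV := vbasis {:V}; pose eW := vbasis {:W}.
pose cW i : 'Hom(W, R[i]^o) := linfun (fun w => coord eW i w : R[i]^o).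
have cWE i w : cW i w = coord eW i w.
  by apply: linfunE_lin => k x y; rewrite linearP.
pose E i j : 'Hom(V, W) := linfun (fun v => coord eV i v *: eW`_j).
have EE i j u : E i j u = coord eV i u *: eW`_j.
  by apply: linfunE_lin => k x y; rewrite linearP /= scalerDl scalerA.
have sE t : s t =
    \sum_(i < \dim {:V}) \sum_(j < \dim {:W}) cW j (s t eV`_i) *: E i j.
  apply/lfunP => u; rewrite sum_lfunE {1}(coord_vbasis (memvf u)) linear_sum.
  apply: eq_bigr => i _; rewrite sum_lfunE linearZ /=.
  rewrite {1}(coord_vbasis (memvf (s t eV`_i))) scaler_sumr.
  apply: eq_bigr => j _; rewrite scale_lfunE EE !scalerA cWE.
  by rewrite mulrC.
have lE t : l (Phi (s t) v) =
    \sum_(i < \dim {:V}) \sum_(j < \dim {:W}) l (Phi (E i j) v) * cW j (s t eV`_i).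
  rewrite {1}sE -[Phi]/(P : _ -> _) linear_sum sum_lfunE linear_sum.
  apply: eq_bigr => i _; rewrite linear_sum sum_lfunE linear_sum.
  apply: eq_bigr => j _; rewrite linearZ scale_lfunE linearZ /=.
  by rewrite mulrC.
have : cpath (fun t => l (Phi (s t) v)).
  rewrite (_ : (fun t => _) = fun t => \sum_(i < \dim {:V})
      \sum_(j < \dim {:W}) l (Phi (E i j) v) * cW j (s t eV`_i)).
    by apply: cpath_sum => i; apply: cpath_sum => j; apply: cpathZ; apply: cs.
  by apply/funext => t; rewrite lE.
by [].
Qed.

End Continuity.

Section KFunctors.
Variable R : realType.

(** An additive functor between the categories of all module maps which
   restricts to the subcategories of degree zero maps. [kf_map] is defined on
   all linear maps, so that continuous paths can be transported by linearity,
   but it is functorial only on module maps. [kf_op0] makes the inclusions of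
   the summands of a direct sum into module maps. *)
Record kfunctor (M N : modtheory R[i]) := KFunctor {
  kf_obj : mobj M -> mobj N;
  kf_map : forall E F : mobj M, 'Hom(E, F) -> 'Hom(kf_obj E, kf_obj F);
  kf_op0 : forall (E : mobj M) x, gs_op E x 0 = 0;
  kf_linear : forall E F, linear (@kf_map E F);
  kf_id : forall E : mobj M, kf_map (\1%VF : 'Hom(E, E)) = \1%VF;
  kf_comp : forall (E F G : mobj M) (f : 'Hom(E, F)) (g : 'Hom(F, G)),
    mod_map f -> mod_map g -> kf_map (g \o f)%VF = (kf_map g \o kf_map f)%VF;
  kf_mod : forall (E F : mobj M) (f : 'Hom(E, F)),
    mod_map f -> mod_map (kf_map f);
  kf_deg : forall (E F : mobj M) (f : 'Hom(E, F)),
    mod_map f -> degree0 f -> degree0 (kf_map f) }.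

Section Projections.
Variables (M : modtheory R[i]) (E F : mobj M).

Definition msum_fst : 'Hom(mobj_sum E F, E) := linfun fst.
Definition msum_snd : 'Hom(mobj_sum E F, F) := linfun snd.
Definition msum_inl : 'Hom(E, mobj_sum E F) := linfun (fun v => (v, 0)).
Definition msum_inr : 'Hom(F, mobj_sum E F) := linfun (fun v => (0, v)).
Definition msum_pair (D : mobj M) (f : 'Hom(D, E)) (g : 'Hom(D, F)) :
  'Hom(D, mobj_sum E F) := linfun (fun v => (f v, g v)).

Lemma msum_fstE v : msum_fst v = v.1. Proof. exact: lfunE. Qed.
Lemma msum_sndE v : msum_snd v = v.2. Proof. exact: lfunE. Qed.
Lemma msum_inlE v : msum_inl v = (v, 0).
Proof.
by apply: linfunE_lin => k x y; congr pair; rewrite /= scaler0 addr0.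
Qed.
Lemma msum_inrE v : msum_inr v = (0, v).
Proof.
by apply: linfunE_lin => k x y; congr pair; rewrite /= scaler0 addr0.
Qed.
Lemma msum_pairE D f g v : @msum_pair D f g v = (f v, g v).
Proof. by apply: linfunE_lin => k x y; congr pair; rewrite linearP. Qed.

Lemma msum_fst_mod : mod_map msum_fst.
Proof. by move=> x v; rewrite !msum_fstE. Qed.
Lemma msum_snd_mod : mod_map msum_snd.
Proof. by move=> x v; rewrite !msum_sndE. Qed.

Lemma msum_fst_deg : degree0 msum_fst.
Proof. by move=> i v; rewrite msum_fstE gsum_grP => /andP[]. Qed.
Lemma msum_snd_deg : degree0 msum_snd.
Proof. by move=> i v; rewrite msum_sndE gsum_grP => /andP[]. Qed.

Lemma msum_pair_mod D f g : mod_map f -> mod_map g -> mod_map (@msum_pair D f g).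
Proof. by move=> mf mg x v; rewrite !msum_pairE mf mg. Qed.

Lemma msum_pair_deg D f g : degree0 f -> degree0 g -> degree0 (@msum_pair D f g).
Proof.
by move=> df dg i v vi; rewrite msum_pairE gsum_grP /= df ?dg.
Qed.

Lemma hom_sumE (D H : mobj M) (f : 'Hom(D, E)) (g : 'Hom(H, F)) v :
  hom_sum f g v = (f v.1, g v.2).
Proof. exact: lfunE. Qed.

End Projections.

Section OnTriples.
Variables (M N : modtheory R[i]) (Phi : kfunctor M N).
Local Notation PhiO := (kf_obj Phi).
Local Notation PhiM := (@kf_map M N Phi _ _).

Lemma kf_iso (E F : mobj M) (f : 'Hom(E, F)) : mod_iso f -> mod_iso (PhiM f).
Proof.
move=> isof; have [mf bf] := isof; have [mg _] := mod_iso_inv isof.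
apply: (@mod_iso_cancel _ _ _ _ _ (PhiM f^-1%VF)); first exact: kf_mod.
  rewrite -kf_comp // -(kf_id Phi); congr (kf_map _ _).
  by apply/lfunP => v; rewrite !lfunE /= bij_lfunVK.
rewrite -kf_comp // -(kf_id Phi); congr (kf_map _ _).
by apply/lfunP => v; rewrite !lfunE /= bij_lfunKV.
Qed.

Lemma kf_inv (E F : mobj M) (f : 'Hom(E, F)) :
  mod_iso f -> PhiM f^-1%VF = (PhiM f)^-1%VF.
Proof.
move=> isof; have [mf bf] := isof; have [mg _] := mod_iso_inv isof.
have [_ bPf] := kf_iso isof; apply/lfunP => v.
apply: (bij_inj bPf); rewrite bij_lfunKV // -comp_lfunE -kf_comp //.
rewrite -[RHS](id_lfunE v) -(kf_id Phi); congr (kf_map _ _ _).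
by apply/lfunP => w; rewrite !lfunE /= bij_lfunKV.
Qed.

Definition kf_triple (t : triple M) : triple N := Triple (kf_iso (tsP t)).

(** Triples related by degree zero isomorphisms commuting with the given maps
   are homotopic, by a constant path. *)
Lemma homotopic_iso (K : modtheory R[i]) (t u : triple K)
    (f : 'Hom(tE t, tE u)) (g : 'Hom(tF t, tF u)) :
  mod_iso f -> degree0 f -> mod_iso g -> degree0 g ->
  (forall v, g (ts t v) = ts u (f v)) -> homotopic t u.
Proof.
move=> isof df isog dg eqgf; exists f, g, (fun _ => ts t); split => //.
- exact: continuous_path_cst.
- by move=> x _; apply: tsP.
split=> //; apply/lfunP => v; rewrite !comp_lfunE -eqgf bij_lfunVK //.
by case: isog.
Qed.

(** The image of a path is a path since [kf_map] is linear. *)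
Lemma kf_homotopic (t u : triple M) :
  homotopic t u -> homotopic (kf_triple t) (kf_triple u).
Proof.
move=> [f [g [s [[isof df] [isog dg] cs iss [s0 s1]]]]].
exists (PhiM f), (PhiM g), (fun x => PhiM (s x)); split.
- by split; [exact: kf_iso | apply: kf_deg => //; case: isof].
- by split; [exact: kf_iso | apply: kf_deg => //; case: isog].
- exact: (continuous_path_linear (@kf_linear _ _ Phi _ _) cs).
- by move=> x x01; apply: kf_iso; apply: iss.
split; first by rewrite s0.
have [mf _] := isof; have [mu _] := tsP u; have [mg _] := mod_iso_inv isog.
rewrite s1 kf_comp //; last exact: mod_map_comp.
by rewrite kf_comp // kf_inv.
Qed.

Lemma kf_elementary (t : triple M) : elementary t -> elementary (kf_triple t).
Proof. by apply: kf_deg; case: (tsP t). Qed.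

Section Sum.
Variables E F : mobj M.

(** The comparison map of an additive functor with the direct sum; its inverse
   is the sum of the images of the two inclusions. *)
Definition kf_split : 'Hom(PhiO (mobj_sum E F), mobj_sum (PhiO E) (PhiO F)) :=
  msum_pair (PhiM (msum_fst E F)) (PhiM (msum_snd E F)).

Lemma kf_split_deg : degree0 kf_split.
Proof.
apply: msum_pair_deg; apply: kf_deg.
- exact: msum_fst_mod.
- exact: msum_fst_deg.
- exact: msum_snd_mod.
- exact: msum_snd_deg.
Qed.

Lemma kf_split_iso : mod_iso kf_split.
Proof.
pose i1 := msum_inl E F; pose i2 := msum_inr E F.
pose p1 := msum_fst E F; pose p2 := msum_snd E F.
have mi1 : mod_map i1.
  by move=> x v; rewrite !msum_inlE; congr pair; rewrite (kf_op0 Phi).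
have mi2 : mod_map i2.
  by move=> x v; rewrite !msum_inrE; congr pair; rewrite (kf_op0 Phi).
have mp1 : mod_map p1 := @msum_fst_mod _ E F.
have mp2 : mod_map p2 := @msum_snd_mod _ E F.
have PhiD (D H : mobj M) (f g : 'Hom(D, H)) : PhiM (f + g) = PhiM f + PhiM g.
  by have := kf_linear Phi 1 f g; rewrite !scale1r.
have Phi0 (D H : mobj M) : PhiM (0 : 'Hom(D, H)) = 0.
  by apply: (addrI (PhiM (0 : 'Hom(D, H)))); rewrite -PhiD !addr0.
have p1i1 : (p1 \o i1 = \1)%VF.
  by apply/lfunP => v; rewrite lfunE /= msum_fstE msum_inlE lfunE.
have p2i2 : (p2 \o i2 = \1)%VF.
  by apply/lfunP => v; rewrite lfunE /= msum_sndE msum_inrE lfunE.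
have p1i2 : (p1 \o i2 = 0)%VF.
  by apply/lfunP => v; rewrite lfunE /= msum_fstE msum_inrE lfunE.
have p2i1 : (p2 \o i1 = 0)%VF.
  by apply/lfunP => v; rewrite lfunE /= msum_sndE msum_inlE lfunE.
have sum1 : ((i1 \o p1) + (i2 \o p2) = \1)%VF.
  apply/lfunP => -[v w]; rewrite !lfunE /= !lfunE /= msum_inlE msum_inrE.
  by rewrite msum_fstE msum_sndE; congr pair; rewrite /= ?addr0 ?add0r.
have E1 (D : mobj M) (f : 'Hom(D, D)) v : f = \1%VF -> PhiM f v = v.
  by move=> ->; rewrite kf_id lfunE.
apply: (@mod_iso_cancel _ _ _ _ _
  ((PhiM i1 \o msum_fst (PhiO E) (PhiO F)) +
   (PhiM i2 \o msum_snd (PhiO E) (PhiO F)))%VF).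
- by apply: msum_pair_mod; apply: kf_mod.
- apply/lfunP => v; rewrite comp_lfunE add_lfunE !comp_lfunE id_lfunE.
  rewrite msum_fstE msum_sndE msum_pairE /=.
  rewrite -[PhiM i1 _]comp_lfunE -[PhiM i2 _]comp_lfunE -!kf_comp //.
  by rewrite -add_lfunE -PhiD E1.
apply/lfunP => -[v w]; rewrite comp_lfunE add_lfunE !comp_lfunE id_lfunE.
  rewrite msum_fstE msum_sndE msum_pairE /=.
rewrite !linearD /= -!comp_lfunE -!kf_comp // p1i1 p1i2 p2i1 p2i2 !Phi0 !E1 //.
by rewrite !lfunE /= addr0 add0r.
Qed.

End Sum.

Lemma kf_split_nat (t u : triple M) v :
  kf_split (tF t) (tF u) (PhiM (ts (triple_sum t u)) v) =
  hom_sum (PhiM (ts t)) (PhiM (ts u)) (kf_split (tE t) (tE u) v).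
Proof.
have [mt _] := tsP t; have [mu _] := tsP u; have [mtu _] := tsP (triple_sum t u).
rewrite hom_sumE !msum_pairE /= -!comp_lfunE -!kf_comp //; first last.
- exact: msum_fst_mod.
- exact: msum_snd_mod.
- exact: msum_fst_mod.
- exact: msum_snd_mod.
congr pair; congr (fun_of_lfun (kf_map _ _) _); apply/lfunP => w; rewrite !comp_lfunE.
  by rewrite !msum_fstE hom_sumE.
by rewrite !msum_sndE hom_sumE.
Qed.

Lemma kf_triple_sum (t u : triple M) :
  homotopic (kf_triple (triple_sum t u)) (triple_sum (kf_triple t) (kf_triple u)).
Proof.
apply: (@homotopic_iso N (kf_triple (triple_sum t u))
  (triple_sum (kf_triple t) (kf_triple u)) (kf_split _ _) (kf_split _ _)).
- exact: kf_split_iso.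
- exact: kf_split_deg.
- exact: kf_split_iso.
- exact: kf_split_deg.
exact: kf_split_nat.
Qed.

Fixpoint kf_expr (x : kexpr M) : kexpr N :=
  match x with
  | KGen t => KGen (kf_triple t)
  | KZero => KZero N
  | KOpp x => KOpp (kf_expr x)
  | KAdd x y => KAdd (kf_expr x) (kf_expr y)
  end.

Lemma kf_expr_keq x y : keq x y -> keq (kf_expr x) (kf_expr y).
Proof.
elim=> {x y} /=.
- by move=> x; apply: keq_refl.
- by move=> x y _; apply: keq_sym.
- by move=> x y z _ xy _; apply: keq_trans.
- by move=> x y _; apply: keq_opp.
- by move=> x x' y y' _ xx' _; apply: keq_add.
- by move=> x y z; apply: keq_addA.
- by move=> x y; apply: keq_addC.
- by move=> x; apply: keq_add0.
- by move=> x; apply: keq_addN.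
- move=> t u; apply: keq_trans (keq_sum _ _).
  exact/keq_homotopic/kf_triple_sum.
- by move=> t u tu; apply/keq_homotopic/kf_homotopic.
- by move=> t et; apply/keq_elementary/kf_elementary.
Qed.

Definition kf_group (a : Kgroup M) : Kgroup N := kclass (kf_expr (krepr a)).

Lemma kf_groupE x : kf_group (kclass x) = kclass (kf_expr x).
Proof. by apply/kclassP/kf_expr_keq/krepr_class. Qed.

Lemma kf_groupD : {morph kf_group : a b / kadd a b >-> kadd a b}.
Proof.
by move=> a b; rewrite -(kreprK a) -(kreprK b) kaddE !kf_groupE kaddE.
Qed.

End OnTriples.

(** A composite of functors which is naturally isomorphic to the identity, by
   isomorphisms of degree zero, induces the identity of the K-group. *)
Lemma kf_group_cancel (M N : modtheory R[i]) (Phi : kfunctor M N)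
    (Psi : kfunctor N M)
    (eta : forall E : mobj M, 'Hom(kf_obj Psi (kf_obj Phi E), E)) :
  (forall E, mod_iso (eta E)) -> (forall E, degree0 (eta E)) ->
  (forall (E F : mobj M) (f : 'Hom(E, F)) v, mod_map f ->
     eta F (kf_map Psi (kf_map Phi f) v) = f (eta E v)) ->
  cancel (kf_group Phi) (kf_group Psi).
Proof.
move=> eta_iso eta_deg eta_nat a; rewrite -(kreprK a) !kf_groupE.
apply/kclassP; elim: (krepr a) => /= [t||x IH|x IHx y IHy].
- apply/keq_homotopic.
  apply: (@homotopic_iso M (kf_triple Psi (kf_triple Phi t)) t
    (eta (tE t)) (eta (tF t))).
  + exact: eta_iso.
  + exact: eta_deg.
  + exact: eta_iso.
  + exact: eta_deg.
  by move=> v; apply: eta_nat; case: (tsP t).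
- exact: keq_refl.
- exact: keq_opp.
- exact: keq_add.
Qed.

(** The K-group depends only on the category of all module maps together with
   the degree zero maps in it, up to equivalence. *)
Lemma kequivalence (M N : modtheory R[i]) (Phi : kfunctor M N)
    (Psi : kfunctor N M)
    (eta : forall E : mobj M, 'Hom(kf_obj Psi (kf_obj Phi E), E))
    (eps : forall E : mobj N, 'Hom(kf_obj Phi (kf_obj Psi E), E)) :
  (forall E, mod_iso (eta E)) -> (forall E, degree0 (eta E)) ->
  (forall (E F : mobj M) (f : 'Hom(E, F)) v, mod_map f ->
     eta F (kf_map Psi (kf_map Phi f) v) = f (eta E v)) ->
  (forall E, mod_iso (eps E)) -> (forall E, degree0 (eps E)) ->
  (forall (E F : mobj N) (f : 'Hom(E, F)) v, mod_map f ->
     eps F (kf_map Phi (kf_map Psi f) v) = f (eps E v)) ->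
  Kisomorphic M N.
Proof.
move=> *; exists (kf_group Phi); split; last exact: kf_groupD.
by exists (kf_group Psi); [exact: (@kf_group_cancel _ _ _ _ eta) |
  exact: (@kf_group_cancel _ _ _ _ eps)].
Qed.

Lemma Kisomorphic_sym (M N : modtheory R[i]) : Kisomorphic M N -> Kisomorphic N M.
Proof.
move=> [f [[g fK gK] fD]]; exists g; split; first by exists f.
by move=> a b; apply: (can_inj fK); rewrite fD !gK.
Qed.

Lemma Kisomorphic_trans (M N L : modtheory R[i]) :
  Kisomorphic M N -> Kisomorphic N L -> Kisomorphic M L.
Proof.
move=> [f [fbij fD]] [g [gbij gD]]; exists (g \o f).
by split; [exact: bij_comp | move=> a b; rewrite /= fD gD].
Qed.

End KFunctors.


Section SameSpace.
Variable R : realType.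

Definition reop (K : fieldType) (X Y : Type) (E : gspace K X)
  (op : Y -> E -> E) : gspace K Y := GSpace (gs_grading E) op.

Section Functor.
Variables (M N : modtheory R[i]).
Variable tr : forall E : gspace R[i] (mt_op M), mt_op N -> E -> E.
Hypothesis tr_mod : forall E : mobj M, is_mod (reop (@tr E)).
Hypothesis op0 : forall (E : mobj M) x, gs_op E x 0 = 0.
Hypothesis tr_map : forall (E F : mobj M) (f : 'Hom(E, F)),
  mod_map f -> forall y v, f (tr y v) = tr y (f v).

Definition reop_functor : kfunctor M N.
Proof.
exists (fun E => MObj (tr_mod E)) (fun E F (f : 'Hom(E, F)) => f) => //.
Defined.

End Functor.

(** Two descriptions of the same modules: the operators of either kind are
   recovered from those of the other on the same graded space. *)
Lemma Kisomorphic_reop (M N : modtheory R[i])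
    (tr : forall E : gspace R[i] (mt_op M), mt_op N -> E -> E)
    (rt : forall E : gspace R[i] (mt_op N), mt_op M -> E -> E) :
  (forall E : mobj M, is_mod (reop (@tr E))) ->
  (forall E : mobj N, is_mod (reop (@rt E))) ->
  (forall (E : mobj M) x, gs_op E x 0 = 0) ->
  (forall (E : mobj N) x, gs_op E x 0 = 0) ->
  (forall (E F : mobj M) (f : 'Hom(E, F)), mod_map f ->
     forall y v, f (tr E y v) = tr F y (f v)) ->
  (forall (E F : mobj N) (f : 'Hom(E, F)), mod_map f ->
     forall y v, f (rt E y v) = rt F y (f v)) ->
  (forall (E : mobj M) x v, rt (reop (@tr E)) x v = gs_op E x v) ->
  (forall (E : mobj N) x v, tr (reop (@rt E)) x v = gs_op E x v) ->
  Kisomorphic M N.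
Proof.
move=> trM rtM M0 N0 trm rtm trK rtK.
pose Phi := reop_functor trM M0 trm; pose Psi := reop_functor rtM N0 rtm.
pose eta (E : mobj M) : 'Hom(kf_obj Psi (kf_obj Phi E), E) := \1%VF.
pose eps (E : mobj N) : 'Hom(kf_obj Phi (kf_obj Psi E), E) := \1%VF.
apply: (@kequivalence R M N Phi Psi eta eps).
- move=> E; split; last by exists id => v; rewrite lfunE.
  by move=> x v; rewrite !lfunE /= trK.
- by move=> E i v; rewrite lfunE.
- by move=> E F f v _; rewrite !lfunE.
- move=> E; split; last by exists id => v; rewrite lfunE.
  by move=> x v; rewrite !lfunE /= rtK.
- by move=> E i v; rewrite lfunE.
- by move=> E F f v _; rewrite !lfunE.
Qed.

End SameSpace.

(** * Modules given by Clifford generators *)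

Section CliffordModules.
Variables (R : realType) (G : magnetic) (A : magalg R G).
Variables (X : eqType) (eta : X -> bool) (rho : G -> G -> R[i]) (k : bool).

Variant clop := ClA of A | ClX of X | ClG of G.

(** Graded [A]-modules with odd operators [ClX x] of square [(-1)^(eta x)],
   anticommuting with each other and with the odd elements of [A], and with
   semilinear operators [ClG g] composing by the factor [rho]. Multiplying the
   antilinear [ClG g] by a generator changes their parity, which is why they are
   allowed to be odd, with [k] true. *)
Record is_cl_mod (E : gspace R[i] clop) : Prop := IsClMod {
  cl_addl : forall a b v,
    gs_op E (ClA (a + b)) v = gs_op E (ClA a) v + gs_op E (ClA b) v;
  cl_addr : forall a u v,
    gs_op E (ClA a) (u + v) = gs_op E (ClA a) u + gs_op E (ClA a) v;
  cl_one : forall v, gs_op E (ClA 1) v = v;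
  cl_mul : forall a b v,
    gs_op E (ClA (a * b)) v = gs_op E (ClA a) (gs_op E (ClA b) v);
  cl_scale : forall (z : R[i]) v, gs_op E (ClA (z *: 1)) v = z *: v;
  cl_gr : forall i j a v, a \in gr A i -> v \in gs_gr E j ->
    gs_op E (ClA a) v \in gs_gr E (i (+) j);
  clX_add : forall x u v,
    gs_op E (ClX x) (u + v) = gs_op E (ClX x) u + gs_op E (ClX x) v;
  clX_sq : forall x v, gs_op E (ClX x) (gs_op E (ClX x) v) = (-1) ^+ eta x *: v;
  clX_anti : forall x y v, x != y ->
    gs_op E (ClX x) (gs_op E (ClX y) v) = - gs_op E (ClX y) (gs_op E (ClX x) v);
  clX_A : forall x a v, gs_op E (ClX x) (gs_op E (ClA a) v) =
    gs_op E (ClA (ksign true a)) (gs_op E (ClX x) v);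
  clX_gr : forall x j v, v \in gs_gr E j -> gs_op E (ClX x) v \in gs_gr E (~~ j);
  clG_add : forall g u v,
    gs_op E (ClG g) (u + v) = gs_op E (ClG g) u + gs_op E (ClG g) v;
  clG_id : forall v, gs_op E (ClG 1%g) v = v;
  clG_mul : forall g h v,
    gs_op E (ClG g) (gs_op E (ClG h) v) = rho g h *: gs_op E (ClG (g * h)%g) v;
  clG_A : forall g a v, gs_op E (ClG g) (gs_op E (ClA a) v) =
    gs_op E (ClA (ksign (k && phi g) (ma_act g a))) (gs_op E (ClG g) v);
  clG_X : forall g x v, gs_op E (ClG g) (gs_op E (ClX x) v) =
    (-1) ^+ (k && phi g) *: gs_op E (ClX x) (gs_op E (ClG g) v);
  clG_gr : forall g j v, v \in gs_gr E j ->
    gs_op E (ClG g) v \in gs_gr E (j (+) (k && phi g)) }.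

Lemma cl_mod_sum E F : is_cl_mod E -> is_cl_mod F -> is_cl_mod (gsum E F).
Proof.
move=> mE mF; split.
- by move=> a b [v w]; congr pair; rewrite cl_addl.
- by move=> a [v w] [v' w']; congr pair; rewrite cl_addr.
- by move=> [v w]; congr pair; rewrite cl_one.
- by move=> a b [v w]; congr pair; rewrite cl_mul.
- by move=> z [v w]; congr pair; rewrite cl_scale.
- move=> i j a [v w] ai; rewrite /gs_gr /= !gsum_grP /= => /andP[vj wj].
  by rewrite !cl_gr.
- by move=> x [v w] [v' w']; congr pair; rewrite clX_add.
- by move=> x [v w]; congr pair; rewrite clX_sq.
- by move=> x y [v w] xy; rewrite /= (clX_anti mE) // (clX_anti mF).
- by move=> x a [v w]; congr pair; rewrite clX_A.
- move=> x j [v w]; rewrite /gs_gr /= !gsum_grP /= => /andP[vj wj].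
  by rewrite !clX_gr.
- by move=> g [v w] [v' w']; congr pair; rewrite clG_add.
- by move=> [v w]; congr pair; rewrite clG_id.
- by move=> g h [v w]; congr pair; rewrite clG_mul.
- by move=> g a [v w]; congr pair; rewrite clG_A.
- by move=> g x [v w]; congr pair; rewrite clG_X.
- move=> g j [v w]; rewrite /gs_gr /= !gsum_grP /= => /andP[vj wj].
  by rewrite !clG_gr.
Qed.

Definition cl_modules : modtheory R[i] := ModTheory cl_mod_sum.

Section Theory.
Variables (E : gspace R[i] clop) (mE : is_cl_mod E).

Lemma cl_scalel z a v : gs_op E (ClA (z *: a)) v = z *: gs_op E (ClA a) v.
Proof. by rewrite -mulr_algl cl_mul // cl_scale. Qed.

Lemma cl_scaler a z v : gs_op E (ClA a) (z *: v) = z *: gs_op E (ClA a) v.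
Proof. by rewrite -cl_scale // -cl_mul // -scalerAr mulr1 cl_scalel. Qed.

Lemma clX_scale x z v : gs_op E (ClX x) (z *: v) = z *: gs_op E (ClX x) v.
Proof. by rewrite -cl_scale // clX_A // ksignZ ksign1 cl_scale. Qed.

Lemma clG_scale g z v :
  gs_op E (ClG g) (z *: v) = conjb (phi g) z *: gs_op E (ClG g) v.
Proof. by rewrite -(cl_scale mE z v) clG_A // ma_actZ ma_act1 ksignZ ksign1 cl_scale. Qed.

Lemma cl_op0 x : gs_op E x 0 = 0.
Proof.
by case: x => [a|x|g]; rewrite -{1}(scale0r 0) ?cl_scaler ?clX_scale ?clG_scale
  ?scale0r // /conjb; case: (phi g); rewrite ?conjc0 scale0r.
Qed.

Lemma cl_opN x v : gs_op E x (- v) = - gs_op E x v.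
Proof.
apply/eqP; rewrite -subr_eq0 opprK; apply/eqP.
by case: x => [a|x|g]; rewrite -?cl_addr -?clX_add -?clG_add // addNr cl_op0.
Qed.

Lemma cl_opB x u v : gs_op E x (u - v) = gs_op E x u - gs_op E x v.
Proof.
by rewrite -cl_opN; case: x => [a|x|g]; rewrite ?cl_addr ?clX_add ?clG_add.
Qed.

Lemma cl_op_sum x (I : Type) (r : seq I) (P : pred I) (F : I -> E) :
  gs_op E x (\sum_(i <- r | P i) F i) = \sum_(i <- r | P i) gs_op E x (F i).
Proof.
apply: (big_morph (gs_op E x)); last exact: cl_op0.
by case: x => [a|x|g] u v; rewrite ?cl_addr ?clX_add ?clG_add.
Qed.

Lemma clA_0 v : gs_op E (ClA 0) v = 0.
Proof. by rewrite -(scale0r (0 : A)) cl_scalel scale0r. Qed.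

Lemma clA_suml (I : Type) (r : seq I) (P : pred I) (F : I -> A) v :
  gs_op E (ClA (\sum_(i <- r | P i) F i)) v =
  \sum_(i <- r | P i) gs_op E (ClA (F i)) v.
Proof.
apply: (big_morph (fun a => gs_op E (ClA a) v)); last exact: clA_0.
by move=> a b; rewrite cl_addl.
Qed.

End Theory.
End CliffordModules.

Arguments ClA {R G A X} a.
Arguments ClX {R G A X} x.
Arguments ClG {R G A X} g.

(** * Equivariant and crossed modules *)

Section NoGenerators.
Variables (R : realType) (G : magnetic) (A : magalg R G).
Local Notation clA0 := (@cl_modules R G A void (fun _ => false)).

Definition equiv_to_cl (E : gspace R[i] (A + G)) (x : clop A void) : E -> E :=
  match x with
  | ClA a => gs_op E (inl a)
  | ClX y => of_void _ y
  | ClG g => gs_op E (inr g)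
  end.

Definition cl_to_equiv (E : gspace R[i] (clop A void)) (x : A + G) : E -> E :=
  match x with inl a => gs_op E (ClA a) | inr g => gs_op E (ClG g) end.

Lemma equivariant_cl :
  Kisomorphic (equivariant_modules A) (clA0 (fun _ _ => 1) false).
Proof.
have em0 (E : mobj (equivariant_modules A)) x : gs_op E x 0 = 0.
  have mE := moP E; apply: (addrI (gs_op E x 0)).
  by case: x => x; rewrite -?em_addr -?em_actD ?addr0.
apply: (@Kisomorphic_reop R (equivariant_modules A) (clA0 _ _)
  (@equiv_to_cl) (@cl_to_equiv)).
- move=> E; have [] := moP E => *; split=> //=; try by case.
  + by move=> g h v; rewrite scale1r; auto.
  + by move=> g a v; rewrite ksign_false; auto.
  + by move=> g j v; rewrite addbF; auto.
- move=> E; have mE : is_cl_mod (fun=> false) (fun _ _ => 1) false E := moP E.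
  split=> /=.
  + by move=> a b v; rewrite (cl_addl mE).
  + by move=> a u v; rewrite (cl_addr mE).
  + by move=> v; rewrite (cl_one mE).
  + by move=> a b v; rewrite (cl_mul mE).
  + by move=> z v; rewrite (cl_scale mE).
  + by move=> i j a v ai vj; apply: (cl_gr mE).
  + by move=> g u v; rewrite (clG_add mE).
  + by move=> v; rewrite (clG_id mE).
  + by move=> g h v; rewrite (clG_mul mE) scale1r.
  + by move=> g j v vj; have := clG_gr mE g vj; rewrite addbF.
  + by move=> g a v; rewrite (clG_A mE) ksign_false.
- exact: em0.
- by move=> E; apply: (cl_op0 (moP E)).
- by move=> E F f mf [a|[]|g] v; apply: mf.
- by move=> E F f mf [a|g] v; apply: mf.
- by move=> E [a|g].
- by move=> E [a|[]|g].
Qed.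

Section Crossed.
Variable rho : cocycle R G.
Hypothesis rho1 : rho 1%g 1%g = 1.
Local Notation B := (crossed A rho).
Local Notation sg := (@crossed_single R G A rho).

Let rho1l g : rho 1%g g = 1.
Proof.
rewrite -rho1; exact: (tconv_c1 (th := fun g : G => conjb (phi g)) (@mul1g G)
  (fun z => congr1 (fun b => conjb b z) (phi1 G)) (cc_neq0 rho) (ccP rho)).
Qed.

Let rho1r g : rho g 1%g = 1.
Proof.
rewrite (tconv_cr1 (th := fun g : G => conjb (phi g)) (@mulg1 G) (cc_neq0 rho) (ccP rho)).
by rewrite rho1 conjb1.
Qed.

Let singleAM (a b : A) : sg a 1%g * sg b 1%g = sg (a * b) 1%g.
Proof. by rewrite crossed_singleM rho1 scale1r ma_act_id mulg1. Qed.

Let singleAG (a : A) g : sg a 1%g * sg 1 g = sg a g.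
Proof. by rewrite crossed_singleM rho1l scale1r ma_act1 mulr1 mul1g. Qed.

Let singleGA (a : A) g : sg 1 g * sg a 1%g = sg (ma_act g a) g.
Proof. by rewrite crossed_singleM rho1r scale1r mul1r mulg1. Qed.

Let singleD g : {morph (fun a : A => sg a g) : a b / a + b}.
Proof. by move=> a b; apply/ffunP => h; rewrite !ffunE; case: ifP; rewrite ?addr0. Qed.

Let singleZ1 (z : R[i]) : sg (z *: 1) 1%g = z *: 1.
Proof.
apply/ffunP => h; rewrite !ffunE; case: ifP => _; rewrite ?scaler0 //.
by rewrite rho1 invr1 scale1r.
Qed.

Let single1 : sg (1 : A) 1%g = 1.
Proof. by rewrite -[RHS]scale1r -singleZ1 scale1r. Qed.

Let single_sum (x : B) : x = \sum_g sg (x g) g.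
Proof.
apply/ffunP => h; rewrite sum_ffunE (bigD1 h) //= ffunE eqxx big1 ?addr0 // => g gh.
by rewrite ffunE eq_sym (negPf gh).
Qed.

Definition crossed_to_cl (E : gspace R[i] B) (x : clop A void) : E -> E :=
  match x with
  | ClA a => gs_op E (sg a 1%g)
  | ClX y => of_void _ y
  | ClG g => gs_op E (sg 1 g)
  end.

Definition cl_to_crossed (E : gspace R[i] (clop A void)) (x : B) (v : E) : E :=
  \sum_g gs_op E (ClA (x g)) (gs_op E (ClG g) v).

(** For a normalized cocycle |a, g| = |a, 1| |1, g|, so that a module over the
   crossed product is determined by the action of A = |A, 1| and by that of the
   elements |1, g|. *)
Lemma crossed_cl : Kisomorphic (crossed_modules A rho) (clA0 rho false).
Proof.
have cm0 (E : mobj (crossed_modules A rho)) x : gs_op E x 0 = 0.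
  have mE : is_crossed_mod E := moP E; apply: (addrI (gs_op E x 0)).
  by rewrite -(cm_addr mE) !addr0.
have cm_sum (E : mobj (crossed_modules A rho)) (F : G -> B) v :
    gs_op E (\sum_g F g) v = \sum_g gs_op E (F g) v.
  have mE : is_crossed_mod E := moP E; apply: (big_morph (fun x => gs_op E x v)).
    by move=> x y; rewrite (cm_addl mE).
  by apply: (addrI (gs_op E 0 v)); rewrite -(cm_addl mE) !addr0.
have c_single (E : mobj (clA0 rho false)) a g v :
    cl_to_crossed (sg a g) v = gs_op E (ClA a) (gs_op E (ClG g) v).
  rewrite /cl_to_crossed (bigD1 g) //= ffunE eqxx big1 ?addr0 // => h hg.
  by rewrite ffunE (negPf hg) (clA_0 (moP E : is_cl_mod _ _ _ E)).
apply: (@Kisomorphic_reop R (crossed_modules A rho) (clA0 _ _)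
  (@crossed_to_cl) (@cl_to_crossed)).
- move=> E; have mE : is_crossed_mod E := moP E; split=> /=; try by case.
  + by move=> a b v; rewrite singleD (cm_addl mE).
  + by move=> a u v; rewrite (cm_addr mE).
  + by move=> v; rewrite single1 (cm_one mE).
  + by move=> a b v; rewrite -singleAM (cm_mul mE).
  + by move=> z v; rewrite singleZ1 (cm_scale mE).
  + by move=> i j a v ai vj; apply: (cm_gr mE).
  + by move=> g u v; rewrite (cm_addr mE).
  + by move=> v; rewrite single1 (cm_one mE).
  + move=> g h v; rewrite -(cm_mul mE) crossed_singleM ma_act1 mulr1.
    by rewrite -singleAG (cm_mul mE) singleZ1 (cm_scale mE).
  + by move=> g a v; rewrite ksign_false -!(cm_mul mE) singleGA singleAG.
  + by move=> g [].
  + by move=> g j v vj; rewrite addbF; apply: (cm_gr mE _ (gr1 A)).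
- move=> E; have mE : is_cl_mod (fun=> false) rho false E := moP E.
  have cD (v : E) : {morph (fun x : B => cl_to_crossed x v) : x y / x + y}.
    move=> x y; rewrite /cl_to_crossed -big_split; apply: eq_bigr => g _.
    by rewrite ffunE (cl_addl mE).
  have c0 (v : E) : cl_to_crossed (0 : B) v = 0.
    by apply: (addrI (cl_to_crossed (0 : B) v)); rewrite -cD !addr0.
  split=> /=.
  + by move=> x y v; apply: cD.
  + move=> x u v; rewrite /cl_to_crossed -big_split; apply: eq_bigr => g _.
    by rewrite (clG_add mE) (cl_addr mE).
  + by move=> v; rewrite -single1 c_single (clG_id mE) (cl_one mE).
  + move=> x y v.
    transitivity (\sum_g \sum_h cl_to_crossed (sg (x g) g * sg (y h) h) v).
      rewrite {1}(single_sum x) {1}(single_sum y) mulr_suml.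
      rewrite (big_morph _ (cD v) (c0 v)); apply: eq_bigr => g _.
      by rewrite mulr_sumr (big_morph _ (cD v) (c0 v)).
    rewrite {2}/cl_to_crossed; apply: eq_bigr => g _.
    rewrite {2}/cl_to_crossed !(cl_op_sum mE); apply: eq_bigr => h _.
    rewrite crossed_singleM c_single (clG_A mE) ksign_false (cl_scalel mE) (cl_mul mE).
    by rewrite (clG_mul mE) !(cl_scaler mE).
  + by move=> z v; rewrite -singleZ1 c_single (clG_id mE) (cl_scale mE).
  + move=> i j a g v ai vj; rewrite c_single; apply: (cl_gr mE) => //.
    by have := clG_gr mE g vj; rewrite addbF.
- exact: cm0.
- by move=> E; apply: (cl_op0 (moP E)).
- by move=> E F f mf [a|[]|g] v; apply: mf.
- move=> E F f mf x v; rewrite /cl_to_crossed linear_sum; apply: eq_bigr => g _.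
  by rewrite /= !mf.
- move=> E x v; have mE : is_crossed_mod E := moP E; rewrite {2}(single_sum x) cm_sum.
  by apply: eq_bigr => g _; rewrite /= -(cm_mul mE) singleAG.
- move=> E [a|[]|g] v /=; rewrite c_single.
    by rewrite (clG_id (moP E : is_cl_mod _ _ _ E)).
  by rewrite (cl_one (moP E : is_cl_mod _ _ _ E)).
Qed.

End Crossed.
End NoGenerators.

(** * The universal property of the Clifford algebras *)

Lemma set_ind (I : finType) (P : {set I} -> Prop) :
  P finset.set0 -> (forall i (S : {set I}), i \notin S -> P S -> P (i |: S)%SET) ->
  forall S, P S.
Proof.
move=> P0 PU S; have [n] := ubnP #|S|; elim: n S => // n IH S.
have [->|[i iS]] := set_0Vmem S; first by [].
rewrite ltnS (cardsD1 i) iS => Sn; rewrite -(finset.setD1K iS); apply: PU.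
  by rewrite !inE eqxx.
exact: IH.
Qed.

Section UniversalProperty.
Variables (R : realType) (G : magnetic) (A : magalg R G) (p q : nat).
Variable rho : G -> G -> R[i].
Local Notation I := 'I_(p + q).
Local Notation cl := (magcliff A p q).
Local Notation single := (@cliff_single R[i] A p q).
Local Notation cls := (@cl_sign R[i] p q).
Implicit Types (S T : {set I}) (i j : I).
Local Notation genm := (@cl_modules R G A I (fun i => (p <= i)%N) rho false).
Local Notation algm := (@cl_modules R G cl void (fun=> false) rho false).

Lemma symd1 i S : i \notin S -> symd [set i] S = (i |: S)%SET.
Proof.
move=> iS; apply/setP => j; rewrite in_symd !inE.
by case: eqP => // ->; rewrite (negPf iS).
Qed.

(** The operator of the basis element e_S: the product of the operators of the
   generators in [S], in increasing order. *)
Definition cl_basis (E : gspace R[i] (clop A I)) S (v : E) : E :=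
  foldr (fun i u => if i \in S then gs_op E (ClX i) u else u) v (enum I).

Section Generators.
Variables (E : gspace R[i] (clop A I)).
Hypothesis mE : is_cl_mod (fun i : I => (p <= i)%N) rho false E.
Local Notation X i := (gs_op E (ClX i)).

Let word S (r : seq I) (v : E) : E :=
  foldr (fun i u => if i \in S then X i u else u) v r.

(** The generator e_i is carried past the factors e_j, j < i, of the ordered
   product, each at the cost of a sign, and then meets its place. *)
Lemma clX_basis i S (v : E) :
  X i (cl_basis S v) = cls [set i] S *: cl_basis (symd [set i] S) v.
Proof.
have after (r : seq I) : all (fun j : I => (i < j)%N) r ->
    word (symd [set i] S) r v = word S r v /\
    \prod_(j <- r | j \in S) cl_pair R[i] i j = 1.
  elim: r => [|j r IH] /=; first by rewrite big_nil.
  move=> /andP[ij /IH[-> IH2]]; rewrite big_cons IH2 in_symd !inE /cl_pair.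
  have ji : j != i by rewrite -val_eqE neq_ltn ij orbT.
  by rewrite (negPf ji) eq_sym (negPf ji) ltnNge ltnW //= mulr1 if_same.
have main (r : seq I) : sorted ltn [seq val j | j <- r] -> i \in r ->
    X i (word S r v) = (\prod_(j <- r | j \in S) cl_pair R[i] i j) *:
      word (symd [set i] S) r v.
  elim: r => [|j r IH] //= srt; rewrite in_cons big_cons in_symd finset.in_set1.
  have [ij _|ij /= ir] := eqVneq i j.
    subst j.
    have /after[-> ->] : all (fun j : I => (i < j)%N) r.
      by have := order_path_min ltn_trans srt; rewrite all_map.
    rewrite mulr1 /cl_pair ltnn eqxx /=.
    case: (i \in S) => /=; last by rewrite scale1r.
    by rewrite (clX_sq mE); case: (p <= i)%N.
  have ji : (j < i)%N.
    have := order_path_min ltn_trans srt; rewrite all_map => /allP; exact.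
  have := IH (path_sorted srt) ir; case: (j \in S) => // IH2.
  rewrite (clX_anti mE) // IH2 (clX_scale mE) /cl_pair ji /=.
  by rewrite mulN1r scaleNr.
rewrite /cl_basis -/(word _ _ _) main ?mem_enum //; last first.
  by rewrite val_enum_ord iota_ltn_sorted.
by rewrite -/(word _ _ _) big_enum_cond /cl_sign big_set1.
Qed.

Lemma cl_basis0 (v : E) : cl_basis finset.set0 v = v.
Proof. by rewrite /cl_basis; elim: (enum I) => //= i r ->; rewrite inE. Qed.

Lemma cl_basisU i S (v : E) : i \notin S ->
  cl_basis (i |: S)%SET v = cls [set i] S *: X i (cl_basis S v).
Proof.
by move=> iS; rewrite clX_basis scalerA cl_sign_sq scale1r symd1.
Qed.

Lemma cl_basis1 i (v : E) : cl_basis [set i] v = X i v.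
Proof.
rewrite -[in RHS](cl_basis0 v) clX_basis symd0r /cl_sign.
by rewrite big1 ?scale1r // => j _; rewrite big_set0.
Qed.

Lemma cl_basisZ S z (v : E) : cl_basis S (z *: v) = z *: cl_basis S v.
Proof.
elim/set_ind: S => [|i S iS IH]; first by rewrite !cl_basis0.
by rewrite !cl_basisU // IH (clX_scale mE) scalerA mulrC -scalerA.
Qed.

Lemma cl_basisD S (u v : E) : cl_basis S (u + v) = cl_basis S u + cl_basis S v.
Proof.
elim/set_ind: S => [|i S iS IH]; first by rewrite !cl_basis0.
by rewrite !cl_basisU // IH (clX_add mE) scalerDr.
Qed.

(** The e_S multiply as in the Clifford algebra: by induction on [S] this reduces
   to [clX_basis], since [cl_sign] is bimultiplicative. *)
Lemma cl_basisM S T (v : E) :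
  cl_basis S (cl_basis T v) = cls S T *: cl_basis (symd S T) v.
Proof.
elim/set_ind: S => [|i S iS IH]; first by rewrite cl_basis0 cl_sign0 symd0 scale1r.
rewrite cl_basisU // IH (clX_scale mE) clX_basis !scalerA -symd1 // -symdA.
rewrite cl_sign_symdl cl_sign_symdr; congr (_ *: _).
by rewrite mulrACA cl_sign_sq mul1r mulrC.
Qed.

Lemma cl_basisA S a (v : E) :
  cl_basis S (gs_op E (ClA a) v) = gs_op E (ClA (ksign (odd #|S|) a)) (cl_basis S v).
Proof.
elim/set_ind: S => [|i S iS IH]; first by rewrite !cl_basis0 cards0 ksign_false.
rewrite !cl_basisU // IH (clX_A mE) (cl_scaler mE) -ksign_comp cardsU1 iS.
by rewrite oddD.
Qed.

Lemma cl_basisG S g (v : E) :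
  gs_op E (ClG g) (cl_basis S v) = cl_basis S (gs_op E (ClG g) v).
Proof.
elim/set_ind: S => [|i S iS IH]; first by rewrite !cl_basis0.
rewrite !cl_basisU // (clG_scale mE) (clG_X mE) scale1r IH.
by rewrite conjb_cl_sign.
Qed.

Lemma cl_basis_gr S (j : bool) (v : E) : v \in gs_gr E j ->
  cl_basis S v \in gs_gr E (odd #|S| (+) j).
Proof.
move=> vj; elim/set_ind: S => [|i S iS IH]; first by rewrite cl_basis0 cards0.
rewrite cl_basisU // memvZ // cardsU1 iS oddD /= addNb.
exact: (clX_gr mE).
Qed.

End Generators.

Lemma cl_basis_map (E F : gspace R[i] (clop A I)) (f : 'Hom(E, F)) S (v : E) :
  mod_map f -> f (cl_basis S v) = cl_basis S (f v).
Proof.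
move=> mf; rewrite /cl_basis; elim: (enum I) => //= i r <-.
by case: ifP => // _; rewrite mf.
Qed.

Let singleM (a b : A) S T : single a S * single b T =
  single (cls S T *: (a * ksign (odd #|S|) b)) (symd S T).
Proof. exact: (tconv_single _ _ (fun S => @ksignD _ A _)). Qed.

Let singleD S : {morph (fun a : A => single a S) : a b / a + b}.
Proof. by move=> a b; apply/ffunP => T; rewrite !ffunE; case: ifP; rewrite ?addr0. Qed.

Let singleZ (z : R[i]) (a : A) S : single (z *: a) S = z *: single a S.
Proof. by apply/ffunP => T; rewrite !ffunE; case: ifP; rewrite ?scaler0. Qed.

Let single1 : single 1 finset.set0 = 1.
Proof. by apply/ffunP => S; rewrite !ffunE cl_sign0 invr1 scale1r. Qed.

Let single_sum (x : cl) : x = \sum_S single (x S) S.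
Proof.
apply/ffunP => S; rewrite sum_ffunE (bigD1 S) //= ffunE eqxx big1 ?addr0 // => T TS.
by rewrite ffunE eq_sym (negPf TS).
Qed.

Let single0M (a b : A) S : single a finset.set0 * single b S = single (a * b) S.
Proof. by rewrite singleM cl_sign0 scale1r cards0 ksign_false symd0. Qed.

Let singleM0 (a : A) S : single 1 S * single a finset.set0 = single (ksign (odd #|S|) a) S.
Proof.
by rewrite singleM symd0r mul1r /cl_sign big1 ?scale1r // => j _; rewrite big_set0.
Qed.

Let single_gr (i : bool) (a : A) S : a \in gr A i -> single a S \in gr cl (i (+) odd #|S|).
Proof.
move=> ai; apply/cliff_grP => T; rewrite ffunE; case: eqP => [->|_]; last exact: mem0v.
by rewrite -addbA addbb addbF.
Qed.

Let act_single g (a : A) S : ma_act g (single a S : cl) = single (ma_act g a) S.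
Proof. by apply/ffunP => T; rewrite !ffunE; case: eqP => // _; rewrite ma_act0. Qed.

Definition alg_to_gen (E : gspace R[i] (clop cl void)) (x : clop A I) : E -> E :=
  match x with
  | ClA a => gs_op E (ClA (single a finset.set0 : cl))
  | ClX i => gs_op E (ClA (cliff_gen A i : cl))
  | ClG g => gs_op E (ClG g)
  end.

(** The Clifford algebra is the free A-module on the e_S, and e_S acts by
   [cl_basis]. *)
Definition gen_to_alg (E : gspace R[i] (clop A I)) (x : clop cl void) (v : E) : E :=
  match x with
  | ClA x => \sum_S gs_op E (ClA ((x : cliff A p q) S)) (cl_basis S v)
  | ClX y => of_void _ y
  | ClG g => gs_op E (ClG g) v
  end.

Let alg_to_gen_mod (E : mobj algm) : is_mod (m := genm) (reop (@alg_to_gen E)).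
Proof.
have mE : is_cl_mod (fun=> false) rho false E := moP E.
have ksign_gen i : ksign true (cliff_gen A i : cl) = - (cliff_gen A i : cl).
  by rewrite (ksignE true (single_gr [set i] (gr1 A))) cards1 scaleN1r.
split=> /=.
- by move=> a b v; rewrite singleD (cl_addl mE).
- by move=> a u v; rewrite (cl_addr mE).
- by move=> v; rewrite single1 (cl_one mE).
- by move=> a b v; rewrite -single0M (cl_mul mE).
- by move=> z v; rewrite singleZ single1 (cl_scale mE).
- move=> i j a v ai vj; apply: (cl_gr mE) => //.
  by have := single_gr finset.set0 ai; rewrite cards0 addbF.
- by move=> x u v; rewrite (cl_addr mE).
- move=> i v; rewrite -(cl_mul mE) [_ * _]cliff_gen_sq [(p <= i)%N]leqNgt.
  case: ltnP => _; first by rewrite (cl_one mE) scale1r.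
  by rewrite -scaleN1r (cl_scale mE).
- move=> i j v ij; rewrite -!(cl_mul mE) [X in ClA X](cliff_gen_anticomm A ij).
  by rewrite -scaleN1r (cl_scalel mE) scaleN1r.
- move=> i a v; rewrite -!(cl_mul mE); congr (gs_op E (ClA _) _).
  by rewrite [LHS]singleM0 [RHS]single0M mulr1 cards1.
- move=> i j v vj; rewrite -addTb; apply: (cl_gr mE) => //.
  by have := single_gr [set i] (gr1 A); rewrite cards1.
- by move=> g u v; rewrite (clG_add mE).
- by move=> v; rewrite (clG_id mE).
- by move=> g h v; rewrite (clG_mul mE).
- by move=> g a v; rewrite (clG_A mE) !ksign_false act_single.
- by move=> g i v; rewrite (clG_A mE) ksign_false act_single ma_act1 scale1r.
- by move=> g j v vj; apply: (clG_gr mE).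
Qed.

Section GenToAlg.
Variable E : mobj genm.
Let mE : is_cl_mod (fun i : I => (p <= i)%N) rho false E := moP E.

Let g2a_single a S v :
  gen_to_alg (ClA (single a S : cl)) v = gs_op E (ClA a) (cl_basis S v).
Proof.
rewrite /= (bigD1 S) //= ffunE eqxx big1 ?addr0 // => T TS.
by rewrite ffunE (negPf TS) (clA_0 mE).
Qed.

Let g2aD (v : E) : {morph (fun x : cl => gen_to_alg (ClA x) v) : x y / x + y}.
Proof.
move=> x y; rewrite /= -big_split; apply: eq_bigr => S _.
by rewrite ffunE (cl_addl mE).
Qed.

Let g2a0 (v : E) : gen_to_alg (ClA (0 : cl)) v = 0.
Proof. by apply: (addrI (gen_to_alg (ClA (0 : cl)) v)); rewrite -g2aD !addr0. Qed.

Lemma gen_to_alg_mod : is_mod (m := algm) (reop (@gen_to_alg E)).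
Proof.
split; rewrite [gs_op (reop _)]/gs_op /reop.
- by move=> a b v; apply: g2aD.
- move=> a u v; rewrite /= -big_split; apply: eq_bigr => S _.
  by rewrite (cl_basisD mE) (cl_addr mE).
- by move=> v; rewrite -single1 g2a_single cl_basis0 (cl_one mE).
- move=> x y v.
  transitivity (\sum_S \sum_T
      gen_to_alg (ClA (single (x S) S * single (y T) T : cl)) v).
    rewrite {1}(single_sum x) {1}(single_sum y) mulr_suml.
    rewrite (big_morph _ (g2aD v) (g2a0 v)); apply: eq_bigr => S _.
    by rewrite mulr_sumr (big_morph _ (g2aD v) (g2a0 v)); apply: erefl.
  rewrite [RHS]/=; apply: eq_bigr => S _.
  rewrite -[X in gs_op _ _ X]/(cl_basis S (\sum_T _)).
  rewrite (big_morph _ (cl_basisD mE S) (_ : _ = 0)); last first.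
    by rewrite -{1}(scale0r (0 : E)) (cl_basisZ mE) scale0r.
  rewrite (cl_op_sum mE); apply: eq_bigr => T _.
  rewrite singleM g2a_single (cl_scalel mE) (cl_mul mE) (cl_basisA mE).
  by rewrite (cl_basisM mE) !(cl_scaler mE).
- by move=> z v; rewrite -single1 -singleZ g2a_single cl_basis0 (cl_scale mE).
- move=> i j x v /cliff_grP xi vj; apply: memv_suml => S _.
  have := cl_gr mE (xi S) (cl_basis_gr mE S vj).
  by rewrite addbA -(addbA i) addbb addbF.
- by case.
- by case.
- by case.
- by case.
- by case.
- by move=> g u v; rewrite /= (clG_add mE).
- by move=> v; rewrite /= (clG_id mE).
- by move=> g h v; rewrite /= (clG_mul mE).
- move=> g x v; rewrite ksign_false /= (cl_op_sum mE); apply: eq_bigr => S _.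
  by rewrite (clG_A mE) ksign_false (cl_basisG mE) ffunE.
- by move=> g [].
- by move=> g j v vj; apply: (clG_gr mE).
Qed.

Lemma gen_to_algK x v : alg_to_gen (E := reop (@gen_to_alg E)) x v = gs_op E x v.
Proof.
case: x => [a|i|g] //; rewrite /alg_to_gen [gs_op (reop _)]/gs_op /reop.
  by rewrite g2a_single cl_basis0.
by rewrite g2a_single (cl_one mE) (cl_basis1 mE).
Qed.

End GenToAlg.

(** A module over the Clifford algebra is a module over [A] with operators
   satisfying the Clifford relations. *)
Lemma cliff_universal : Kisomorphic algm genm.
Proof.
apply: (@Kisomorphic_reop R algm genm (@alg_to_gen) (@gen_to_alg)).
- exact: alg_to_gen_mod.
- exact: gen_to_alg_mod.
- by move=> E; apply: (cl_op0 (moP E)).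
- by move=> E; apply: (cl_op0 (moP E)).
- by move=> E F f mf [a|i|g] v; apply: mf.
- move=> E F f mf [x|[]|g] v; last exact: mf.
  rewrite /= linear_sum; apply: eq_bigr => S _.
  by rewrite /= mf (cl_basis_map _ _ mf).
- move=> E [x|[]|g] v //.
  have mE : is_cl_mod (fun=> false) rho false E := moP E.
  have mE' := alg_to_gen_mod E.
  have basisE S : cl_basis (E := reop (@alg_to_gen E)) S v =
      gs_op E (ClA (single 1 S : cl)) v.
    elim/set_ind: S => [|i S iS IH].
      by rewrite cl_basis0 single1 (cl_one mE).
    rewrite (cl_basisU mE') // IH /= -(cl_mul mE) -(cl_scalel mE) singleM.
    by rewrite ksign1 mulr1 singleZ scalerA cl_sign_sq scale1r symd1.
  rewrite /= {2}(single_sum x) (clA_suml mE); apply: eq_bigr => S _.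
  by rewrite basisE /= -(cl_mul mE) single0M mulr1.
- exact: gen_to_algK.
Qed.

End UniversalProperty.

Lemma cl_reindex (R : realType) (G : magnetic) (A : magalg R G) (X Y : eqType)
    (eta : X -> bool) (rho : G -> G -> R[i]) (k : bool) (h : Y -> X) (h' : X -> Y) :
  cancel h h' -> cancel h' h ->
  Kisomorphic (@cl_modules R G A X eta rho k) (@cl_modules R G A Y (eta \o h) rho k).
Proof.
move=> hK h'K.
pose M := @cl_modules R G A X eta rho k.
pose N := @cl_modules R G A Y (eta \o h) rho k.
pose to (x : clop A Y) : clop A X :=
  match x with ClA a => ClA a | ClX y => ClX (h y) | ClG g => ClG g end.
pose from (x : clop A X) : clop A Y :=
  match x with ClA a => ClA a | ClX y => ClX (h' y) | ClG g => ClG g end.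
apply: (@Kisomorphic_reop R M N (fun E x => gs_op E (to x)) (fun E x => gs_op E (from x))).
- move=> E; have mE : is_cl_mod eta rho k E := moP E.
  have [] := mE => *; split=> //= y j v; last exact: (clX_gr mE).
  by move=> yj; rewrite (clX_anti mE) // (can_eq hK).
- move=> E; have mE : is_cl_mod (eta \o h) rho k E := moP E.
  have [] := mE => *; split=> //= x j.
  + by rewrite (clX_sq mE) /= h'K.
  + by move=> v xj; rewrite (clX_anti mE) // (can_eq h'K).
  + by move=> v; apply: (clX_gr mE).
- by move=> E; apply: (cl_op0 (moP E)).
- by move=> E; apply: (cl_op0 (moP E)).
- by move=> E F f mf x v; apply: mf.
- by move=> E F f mf x v; apply: mf.
- by move=> E [a|x|g] v //=; rewrite h'K.
- by move=> E [a|x|g] v //=; rewrite hK.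
Qed.

(** * Removing two generators of square -1 *)

Section TwoGenerators.
Variables (R : realType) (G : magnetic) (A : magalg R G).
Variables (X : eqType) (eta : X -> bool) (rho : G -> G -> R[i]) (k : bool).
Local Notation ii := ('i%C : R[i]).

(** [inr false] and [inr true] stand for the generators f and f' to be removed. *)
Definition eta2 (y : X + bool) : bool := if y is inl x then eta x else true.
(** The new cocycle: f (T g) f (T h) = (-1)^k f f (T g) (T h) for antilinear
   [T g], [T h]. *)
Definition rho2 (g h : G) : R[i] := (-1) ^+ [&& ~~ k, phi g & phi h] * rho g h.

Local Notation M := (@cl_modules R G A (X + bool)%type eta2 rho k).
Local Notation N := (@cl_modules R G A X eta rho2 (~~ k)).

Let iiM : ii * ii = -1.
Proof. by rewrite -expr2 sqr_i. Qed.

Let conj_ii b : conjb b ii = (-1) ^+ b * ii.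
Proof.
case: b; rewrite ?mul1r // expr1 mulN1r /conjb.
by apply/eqP; rewrite eq_complex /= oppr0 !eqxx.
Qed.

Section Eigenspace.
Variable E : gspace R[i] (clop A (X + bool)%type).
Local Notation f := (gs_op E (ClX (inr false))).
Local Notation f' := (gs_op E (ClX (inr true))).

Definition eig : {vspace E} := lker (linfun (fun v => f (f' v) - ii *: v)).

(** An antilinear operator exchanges the eigenspaces of f f' for i and -i, and
   so does f, which anticommutes with f f'. Hence the composite acts on each. *)
Definition eig_op (x : clop A X) (v : E) : E :=
  match x with
  | ClA a => gs_op E (ClA a) v
  | ClX x => gs_op E (ClX (inl x)) v
  | ClG g => if phi g then f (gs_op E (ClG g) v) else gs_op E (ClG g) v
  end.

Hypothesis mE : is_cl_mod eta2 rho k E.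

Lemma eigP v : reflect (f (f' v) = ii *: v) (v \in eig).
Proof.
rewrite memv_ker linfunE_lin; first by rewrite subr_eq0; apply: eqP.
move=> z u w; rewrite !(clX_add mE) !(clX_scale mE) scalerBr scalerDr !scalerA.
by rewrite opprD [z * _]mulrC addrACA.
Qed.

Let ff v : f (f v) = - v.
Proof. by rewrite (clX_sq mE) expr1 scaleN1r. Qed.
Let f'f v : f' (f v) = - f (f' v).
Proof. by rewrite (clX_anti mE). Qed.

Lemma eig_op_eig x v : v \in eig -> eig_op x v \in eig.
Proof.
move=> /eigP Jv; apply/eigP; case: x => [a|x|g] /=.
- by rewrite !(clX_A mE) -ksign_comp addbb ksign_false Jv (cl_scaler mE).
- rewrite (clX_anti mE _ (x := inr true)) // (cl_opN mE).
  by rewrite (clX_anti mE _ (x := inr false)) // opprK Jv (clX_scale mE).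
have JG : f (f' (gs_op E (ClG g) v)) = (-1) ^+ phi g *: (ii *: gs_op E (ClG g) v).
  have := clG_scale mE g ii v.
  rewrite -Jv !(clG_X mE) (clX_scale mE) !scalerA -expr2 sqrr_sign scale1r => ->.
  by rewrite conj_ii.
case: ifP JG => _ JG.
  rewrite f'f (cl_opN mE) JG expr1 scaleN1r !(cl_opN mE) opprK.
  by rewrite (clX_scale mE).
by rewrite JG scale1r.
Qed.

Definition eig_gr (i : bool) : {vspace subvs_of eig} :=
  (linfun (@vsval _ _ eig) @^-1: gs_gr E i)%VS.

Lemma eig_grP i w : (w \in eig_gr i) = (vsval w \in gs_gr E i).
Proof. by rewrite -memv_preim lfunE. Qed.

Lemma eig_grading : is_grading eig_gr.
Proof.
have [sE iE] := gs_grading E; split.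
  apply/eqP; rewrite eqEsubv subvf; apply/subvP => w _.
  have /memv_addP[v0 v0E [v1 v1E wE]] : vsval w \in (gs_gr E false + gs_gr E true)%VS.
    by rewrite sE memvf.
  pose D v := f (f' v) - ii *: v.
  have D0 : D v0 = - D v1.
    have /eigP : vsval w \in eig := subvsP w.
    rewrite wE !(clX_add mE) scalerDr => /eqP; rewrite -subr_eq0 opprD addrACA.
    by rewrite addr_eq0 => /eqP.
  have Dgr i v : v \in gs_gr E i -> D v \in gs_gr E i.
    move=> vi; rewrite rpredB ?memvZ //.
    by rewrite -(negbK i); do 2!apply: (clX_gr mE).
  have Dv0 : D v0 = 0.
    apply/eqP; rewrite -memv0 -iE memv_cap Dgr //= D0 memvN; exact: Dgr.
  have v0e : v0 \in eig by apply/eigP/eqP; rewrite -subr_eq0 -/(D v0) Dv0.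
  have v1e : v1 \in eig.
    by apply/eigP/eqP; rewrite -subr_eq0 -/(D v1) -oppr_eq0 -D0 Dv0.
  have -> : w = vsproj eig v0 + vsproj eig v1.
    by apply: subvs_inj; rewrite linearD /= !vsprojK.
  by apply: memv_add; rewrite eig_grP vsprojK.
apply/eqP; rewrite -subv0; apply/subvP => w.
rewrite memv_cap !eig_grP memv0 -(inj_eq subvs_inj) linear0 -memv0 -iE memv_cap.
by [].
Qed.

Definition eig_gspace : gspace R[i] (clop A X) :=
  @GSpace _ _ (subvs_of eig) eig_gr eig_grading
    (fun x w => vsproj eig (eig_op x (vsval w))).

Lemma eig_val x w : vsval (gs_op eig_gspace x w) = eig_op x (vsval w).
Proof. by rewrite vsprojK // eig_op_eig // subvsP. Qed.

Lemma eig_mod : is_cl_mod eta rho2 (~~ k) eig_gspace.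
Proof.
have vD (u v : eig_gspace) : vsval (u + v) = vsval u + vsval v :> E by rewrite linearD.
have vZ z (u : eig_gspace) : vsval (z *: u) = z *: vsval u :> E by rewrite linearZ.
have vN (u : eig_gspace) : vsval (- u) = - vsval u :> E by rewrite linearN.
split.
- by move=> a b v; apply: subvs_inj; rewrite vD !eig_val /= (cl_addl mE).
- by move=> a u v; apply: subvs_inj; rewrite !(vD, eig_val) /= (cl_addr mE).
- by move=> v; apply: subvs_inj; rewrite eig_val /= (cl_one mE).
- by move=> a b v; apply: subvs_inj; rewrite !eig_val /= (cl_mul mE).
- by move=> z v; apply: subvs_inj; rewrite eig_val /= (cl_scale mE).
- move=> i j a v ai; rewrite !eig_grP eig_val; exact: (cl_gr mE).
- by move=> x u v; apply: subvs_inj; rewrite !(vD, eig_val) /= (clX_add mE).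
- by move=> x v; apply: subvs_inj; rewrite vZ !eig_val /= (clX_sq mE).
- move=> x y v xy; apply: subvs_inj; rewrite vN !eig_val /= (clX_anti mE) //.
- by move=> x a v; apply: subvs_inj; rewrite !eig_val /= (clX_A mE).
- move=> x j v; rewrite !eig_grP eig_val; exact: (clX_gr mE).
- move=> g u v; apply: subvs_inj; rewrite !(vD, eig_val) /= (clG_add mE).
  by case: ifP => // _; rewrite (clX_add mE).
- by move=> v; apply: subvs_inj; rewrite eig_val /= phi1 (clG_id mE).
- move=> g h v; apply: subvs_inj; rewrite vZ !eig_val /= phiM /rho2.
  case: (boolP (phi g)) => pg; case: (boolP (phi h)) => ph /=.
  + rewrite (clG_X mE) pg andbT (clG_mul mE) !(clX_scale mE) ff.
    rewrite -[- gs_op _ _ _]scaleN1r !scalerA; congr (_ *: _).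
    by case: (k); rewrite /= !(expr0, expr1) !(mulN1r, mul1r, mulrN1) ?opprK.
  + by rewrite (clG_mul mE) (clX_scale mE) andbF expr0 mul1r.
  + rewrite (clG_X mE) (negPf pg) andbF scale1r (clG_mul mE) (clX_scale mE).
    by rewrite andbF expr0 mul1r.
  + by rewrite (clG_mul mE) andbF expr0 mul1r.
- move=> g a v; apply: subvs_inj; rewrite !eig_val /= (clG_A mE).
  case: (phi g); rewrite ?andbT ?andbF //.
  by rewrite (clX_A mE) -ksign_comp.
- move=> g x v; apply: subvs_inj; rewrite vZ !eig_val /= (clG_X mE).
  case: (phi g); rewrite ?andbT ?andbF //.
  rewrite (clX_scale mE) (clX_anti mE) // scalerN -scaleNr; congr (_ *: _).
  by case: (k); rewrite !(expr0, expr1) ?opprK.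
- move=> g j v; rewrite !eig_grP eig_val /= => vj; have := clG_gr mE g vj.
  case: (phi g); rewrite ?andbT ?andbF // => /(clX_gr mE (inr false)).
  by rewrite addbN.
Qed.

End Eigenspace.

Section Double.
Variable W : gspace R[i] (clop A X).

Lemma shift_grading : is_grading (fun i => gs_gr W (~~ i)).
Proof.
by have [sW iW] := gs_grading W; split => /=; [rewrite addvC | rewrite capvC].
Qed.

(** The pair (v, w) stands for v + f w, where f f' is i on W. The signs come
   from moving the operators past f; an antilinear T(g) acts on W as - f T'(g),
   since T'(g) = f T(g). *)
Definition dbl_op (x : clop A (X + bool)%type) (v : (W * W)%type) : (W * W)%type :=
  match x with
  | ClA a => (gs_op W (ClA a) v.1, gs_op W (ClA (ksign true a)) v.2)
  | ClX (inl x) => (gs_op W (ClX x) v.1, - gs_op W (ClX x) v.2)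
  | ClX (inr false) => (- v.2, v.1)
  | ClX (inr true) => (- (ii *: v.2), - (ii *: v.1))
  | ClG g => if phi g then ((-1) ^+ k *: gs_op W (ClG g) v.2, - gs_op W (ClG g) v.1)
             else (gs_op W (ClG g) v.1, gs_op W (ClG g) v.2)
  end.

Definition shift : gspace R[i] (clop A X) := GSpace shift_grading (gs_op W).

Definition dbl : gspace R[i] (clop A (X + bool)%type) :=
  @GSpace _ _ (gsum W shift) _ (gsum_grading W shift) dbl_op.

Lemma dbl_grP i (v : dbl) :
  (v \in gs_gr dbl i) = (v.1 \in gs_gr W i) && (v.2 \in gs_gr W (~~ i)).
Proof. exact: gsum_grP. Qed.

Hypothesis mW : is_cl_mod eta rho2 (~~ k) W.

Lemma dbl_mod : is_cl_mod eta2 rho k dbl.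
Proof.
have pairN (v w : W) : - (v, w) = (- v, - w) :> W * W by [].
have pairZ z (v w : W) : z *: (v, w) = (z *: v, z *: w) :> W * W by [].
split; rewrite /gs_op /=.
- by move=> a b [v w]; congr pair; rewrite ?ksignD (cl_addl mW).
- by move=> a [v w] [v' w']; congr pair; rewrite (cl_addr mW).
- by move=> [v w]; congr pair; rewrite ?ksign1 (cl_one mW).
- by move=> a b [v w]; congr pair; rewrite ?ksignM (cl_mul mW).
- by move=> z [v w]; congr pair; rewrite ?ksignZ ?ksign1 (cl_scale mW).
- move=> i j a [v w] ai; rewrite !dbl_grP /= => /andP[vj wj].
  rewrite (cl_gr mW) //= -addbN (cl_gr mW) //; exact: ksign_gr.
- move=> [x|[]] [v w] [v' w']; congr pair => /=.
  + by rewrite (clX_add mW).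
  + by rewrite (clX_add mW) opprD.
  + by rewrite scalerDr opprD.
  + by rewrite scalerDr opprD.
  + by rewrite opprD.
- move=> [x|[]] [v w] /=; rewrite pairZ; congr pair => /=.
  + by rewrite (clX_sq mW).
  + by rewrite (cl_opN mW) opprK (clX_sq mW).
  + by rewrite scalerN opprK scalerA iiM.
  + by rewrite scalerN opprK scalerA iiM.
  + by rewrite expr1 scaleN1r.
  + by rewrite expr1 scaleN1r.
- move=> [x|[]] [y|[]] [v w] //= xy; rewrite ?pairN; congr pair => /=;
    rewrite ?(cl_opN mW) ?(clX_scale mW) ?opprK ?scalerN ?opprK //.
  + by rewrite (clX_anti mW).
  + by rewrite (clX_anti mW).
- move=> [x|[]] a [v w]; congr pair => /=.
  + by rewrite (clX_A mW).
  + by rewrite (clX_A mW) (cl_opN mW).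
  + by rewrite (cl_opN mW) (cl_scaler mW).
  + by rewrite -ksign_comp ksign_false (cl_opN mW) (cl_scaler mW).
  + by rewrite (cl_opN mW).
  + by rewrite -ksign_comp ksign_false.
- move=> [x|[]] j [v w]; rewrite !dbl_grP /= => /andP[vj wj].
  + by rewrite memvN !(clX_gr mW).
  + by rewrite !memvN !memvZ ?negbK.
  + by rewrite memvN wj negbK.
- move=> g [v w] [v' w'] /=; case: ifP => _; congr pair;
    by rewrite /= (clG_add mW) ?scalerDr ?opprD.
- by move=> [v w] /=; rewrite phi1 !(clG_id mW).
- move=> g h [v w] /=; rewrite phiM.
  have gh := clG_mul mW g h; have conj_sign b : conjb b ((-1) ^+ k) = (-1) ^+ k :> R[i].
    exact: conjb_sign.
  rewrite /rho2 in gh.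
  case: (boolP (phi g)) gh => pg; case: (boolP (phi h)) => ph /= gh.
  + rewrite pairZ; congr pair.
      rewrite (cl_opN mW) gh scalerN scalerA -scaleNr andbT; congr (_ *: _).
      by case: (k); rewrite !(expr0, expr1) ?mulN1r ?mul1r ?opprK.
    rewrite (clG_scale mW) conj_sign gh scalerA -scaleNr andbT; congr (_ *: _).
    by case: (k); rewrite !(expr0, expr1) ?mulN1r ?mul1r ?opprK.
  + rewrite pairZ; congr pair; rewrite gh andbF expr0 mul1r ?scalerN //.
    by rewrite !scalerA mulrC.
  + rewrite pairZ; congr pair; rewrite ?(cl_opN mW) ?(clG_scale mW) ?conj_sign;
      rewrite gh andbF expr0 mul1r ?scalerN //.
    by rewrite !scalerA mulrC.
  + by rewrite pairZ; congr pair; rewrite gh andbF expr0 mul1r.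
- move=> g a [v w] /=; case: (boolP (phi g)) => pg; rewrite ?andbT ?andbF; last first.
    by rewrite !(clG_A mW) (negPf pg) !andbF !ksign_false ma_act_ksign.
  rewrite !(clG_A mW) pg andbT; congr pair.
    by rewrite (cl_scaler mW) -ma_act_ksign -ksign_comp addNb addbT negbK.
  by rewrite -ksign_comp (cl_opN mW).
- move=> g x [v w] /=; case: (boolP (phi g)) => pg; rewrite ?andbT ?andbF;
    last first.
    have cZ z u : gs_op W (ClG g) (z *: u) = z *: gs_op W (ClG g) u.
      by rewrite (clG_scale mW) (negPf pg).
    rewrite scale1r; case: x => [x|[]] /=; congr pair;
      by rewrite ?(cl_opN mW) ?(clG_X mW) ?cZ ?(negPf pg) ?andbF ?scale1r.
  have cZ z u : gs_op W (ClG g) (z *: u) = conjc z *: gs_op W (ClG g) u.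
    by rewrite (clG_scale mW) pg.
  have ic : conjc ii = - ii by have := conj_ii true; rewrite expr1 mulN1r.
  have kk : (-1) ^+ k * (-1) ^+ k = 1 :> R[i] by rewrite -expr2 sqrr_sign.
  case: x => [x|[]] /=; rewrite pairZ; congr pair.
  + rewrite (cl_opN mW) (clG_X mW) pg andbT (clX_scale mW) scalerN -scaleNr !scalerA.
    congr (_ *: _); rewrite kk.
    by case: (k); rewrite /= !(expr0, expr1) ?(mulN1r, mul1r, mulNr) ?opprK.
  + rewrite (clG_X mW) pg andbT (cl_opN mW) opprK -scaleNr.
    congr (_ *: _); by case: (k); rewrite !(expr0, expr1) ?opprK.
  + by rewrite (cl_opN mW) cZ ic scaleNr opprK !scalerN opprK.
  + rewrite (cl_opN mW) cZ ic scaleNr opprK scalerN; congr (- _).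
    by rewrite !scalerA mulrAC kk mul1r.
  + by rewrite opprK.
  + by rewrite (cl_opN mW) opprK scalerA kk scale1r.
- move=> g j [v w]; rewrite !dbl_grP /= => /andP[vj wj].
  have := clG_gr mW g vj; have := clG_gr mW g wj.
  case: (phi g); rewrite ?andbT ?andbF ?addbF /= => gw gv; last by rewrite gv gw.
  rewrite memvN memvZ -?addbN //.
  by move: gw; rewrite addNb addbN negbK.
Qed.

End Double.
End TwoGenerators.

Section RemoveTwo.
Variables (R : realType) (G : magnetic) (A : magalg R G).
Variables (X : eqType) (eta : X -> bool) (rho : G -> G -> R[i]) (k : bool).
Local Notation ii := ('i%C : R[i]).
Local Notation M := (@cl_modules R G A (X + bool)%type (eta2 eta) rho k).
Local Notation N := (@cl_modules R G A X eta (rho2 rho k) (~~ k)).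
Local Notation modM E := (moP E : is_cl_mod (eta2 eta) rho k E).
Local Notation modN W := (moP W : is_cl_mod eta (rho2 rho k) (~~ k) W).
Local Notation f E := (gs_op E (ClX (inr false))).
Local Notation f' E := (gs_op E (ClX (inr true))).

Definition eig_obj (E : mobj M) : mobj N := MObj (eig_mod (modM E) : is_mod (m := N) _).

Definition eig_hom (E F : mobj M) (s : 'Hom(E, F)) : 'Hom(eig_obj E, eig_obj F) :=
  linfun (fun w : subvs_of (eig E) => vsproj (eig F) (s (vsval w))).

Lemma eig_homE (E F : mobj M) (s : 'Hom(E, F)) (w : eig_obj E) :
  eig_hom s w = vsproj (eig F) (s (vsval w)).
Proof. by apply: linfunE_lin => z u v; rewrite !linearP. Qed.

Lemma eig_hom_val (E F : mobj M) (s : 'Hom(E, F)) (w : eig_obj E) :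
  mod_map s -> vsval (eig_hom s w) = s (vsval w).
Proof.
move=> ms; rewrite eig_homE vsprojK //; apply/(eigP (modM F) _).
by rewrite -!ms (eigP (modM E) _ (subvsP w)) linearZ.
Qed.

Definition eig_functor : kfunctor M N.
Proof.
exists eig_obj eig_hom.
- by move=> E x; apply: cl_op0 (modM E) _.
- by move=> E F z s t; apply/lfunP => w; rewrite add_lfunE scale_lfunE !eig_homE
    add_lfunE scale_lfunE linearP.
- by move=> E; apply/lfunP => w; rewrite eig_homE !lfunE /= vsvalK.
- move=> E F H s t ms mt; apply/lfunP => w; apply: subvs_inj.
  by rewrite comp_lfunE !eig_hom_val ?comp_lfunE //; apply: mod_map_comp.
- move=> E F s ms x w; apply: subvs_inj.
  rewrite eig_hom_val // !eig_val eig_hom_val //.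
  by case: x => [a|x|g] /=; rewrite ?ms //; case: ifP => _; rewrite !ms.
- move=> E F s ms ds i w; rewrite !eig_grP eig_hom_val //; exact: ds.
Defined.

Definition dbl_obj (W : mobj N) : mobj M := MObj (dbl_mod (modN W) : is_mod (m := M) _).

Definition dbl_hom (W V : mobj N) (s : 'Hom(W, V)) : 'Hom(dbl_obj W, dbl_obj V) :=
  hom_sum s s.

Lemma dbl_homE (W V : mobj N) (s : 'Hom(W, V)) (v : dbl_obj W) :
  dbl_hom s v = (s v.1, s v.2).
Proof. exact: (hom_sumE s s v). Qed.

Definition dbl_functor : kfunctor N M.
Proof.
exists dbl_obj dbl_hom.
- by move=> E x; apply: cl_op0 (modN E) _.
- by move=> E F z s t; apply/lfunP => w; rewrite add_lfunE scale_lfunE !dbl_homE;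
    congr pair; rewrite add_lfunE scale_lfunE.
- by move=> E; apply/lfunP => -[w w']; rewrite dbl_homE !lfunE.
- by move=> E F H s t ms mt; apply/lfunP => w; rewrite comp_lfunE !dbl_homE !comp_lfunE.
- move=> E F s ms x w; rewrite !dbl_homE.
  by case: x => [a|[x|[]]|g] /=; try (case: ifP => _ /=);
    congr pair; rewrite ?linearN ?linearZ /= ?ms.
- move=> E F s ms ds i w; rewrite !dbl_grP dbl_homE /= => /andP[w1 w2].
  by rewrite !ds.
Defined.

Section Counit.
Variable E : mobj M.
Let mE := modM E.
Local Notation U := (eig E).

(** As f f' squares to -1, its eigenspaces for i and -i are complementary; the
   operator f exchanges them, so that the module is [eig E] + f [eig E]. *)
Definition eig_sum : 'Hom(dbl_obj (eig_obj E), E) :=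
  linfun (fun w : (subvs_of U * subvs_of U)%type => vsval w.1 + f E (vsval w.2)).

Lemma eig_sumE (w : dbl_obj (eig_obj E)) : eig_sum w = vsval w.1 + f E (vsval w.2).
Proof.
apply: linfunE_lin => z [u1 u2] [v1 v2] /=; rewrite (clX_add mE) (clX_scale mE).
by rewrite scalerDr addrACA.
Qed.

Let ff v : f E (f E v) = - v.
Proof. by rewrite (clX_sq mE) expr1 scaleN1r. Qed.
Let f'f v : f' E (f E v) = - f E (f' E v).
Proof. by rewrite (clX_anti mE). Qed.
Let iiM : ii * ii = -1.
Proof. by rewrite -expr2 sqr_i. Qed.

Let half (u : E) : 2^-1 *: (u + u) = u.
Proof.
by rewrite -mulr2n -(scaler_nat _ u) scalerA mulVf ?scale1r // pnatr_eq0.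
Qed.

(* The projection onto the eigenspace for i. *)
Let P v : E := 2^-1 *: (v - ii *: f E (f' E v)).

Let f'E u : u \in U -> f' E u = - (ii *: f E u).
Proof.
move=> /(eigP mE _) uU; rewrite -(clX_scale mE) -uU ff opprK //.
Qed.

Let P_eig v : P v \in U.
Proof.
apply/(eigP mE _); rewrite /P !(clX_scale mE) scalerA mulrC -scalerA; congr (_ *: _).
rewrite !(cl_opB mE) !(clX_scale mE) f'f (cl_opN mE) ff opprK.
rewrite (clX_sq mE) expr1 scaleN1r !scalerN opprK scalerBr scalerA iiM scaleN1r opprK.
by rewrite addrC.
Qed.

Let P_id u : u \in U -> P u = u.
Proof.
move=> /(eigP mE _) uU; rewrite /P uU scalerA iiM scaleN1r opprK.
exact: half.
Qed.

Let P_f u : u \in U -> P (f E u) = 0.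
Proof.
move=> /(eigP mE _) uU; rewrite /P f'f (cl_opN mE) uU (clX_scale mE).
by rewrite scalerN scalerA iiM scaleN1r opprK subrr scaler0.
Qed.

Lemma eig_sum_iso : mod_iso eig_sum.
Proof.
split.
  move=> x w; rewrite !eig_sumE.
  have val_op y (u : eig_obj E) : vsval (gs_op (eig_obj E) y u) = eig_op y (vsval u).
    exact: eig_val.
  have valZ z (u : eig_obj E) : vsval (z *: u) = z *: vsval u :> E by rewrite linearZ.
  have valN (u : eig_obj E) : vsval (- u) = - vsval u :> E by rewrite linearN.
  have [w1U w2U] := (subvsP w.1, subvsP w.2).
  case: w w1U w2U => w1 w2 /= w1U w2U.
  change (gs_op (dbl_obj (eig_obj E)) x (w1, w2)) with
    (@dbl_op R G A X k (eig_obj E) x (w1, w2)).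
  case: x => [a|[x|[]]|g]; cbv beta iota delta [dbl_op fst snd].
  - rewrite !val_op /= (clX_A mE) -ksign_comp ksign_false.
    by rewrite (cl_addr mE).
  - by rewrite valN !val_op /= (cl_opN mE) (clX_add mE) (clX_anti mE _ (y := inl x)) //
      opprK.
  - rewrite !valN !valZ (clX_add mE) f'E // f'f f'E // !(cl_opN mE) !(clX_scale mE) ff.
    by rewrite scalerN !opprK addrC.
  - by rewrite valN (clX_add mE) ff addrC.
  rewrite (clG_add mE) (clG_X mE); case: ifP => pg.
    rewrite valZ valN !val_op /= pg (cl_opN mE) ff opprK andbT.
    by rewrite addrC.
  by rewrite !val_op /= pg andbF scale1r.
(* v = P v - f P f v, because - f P f is the projection for -i. *)
exists (fun v => (vsproj U (P v), vsproj U (- P (f E v)))) => [w|v].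
  rewrite eig_sumE; case: w => w1 w2 /=.
  have PD u v : P (u + v) = P u + P v.
    by rewrite /P !(clX_add mE) [ii *: (_ + _)]scalerDr opprD addrACA scalerDr.
  have PN v : P (- v) = - P v.
    by rewrite /P !(cl_opN mE) scalerN opprK -scalerN opprB addrC.
  rewrite (clX_add mE) ff !PD PN !P_f ?P_id ?subvsP // add0r addr0 opprK.
  by rewrite !vsvalK.
rewrite eig_sumE /= !vsprojK ?memvN ?P_eig // (cl_opN mE) /P !(clX_scale mE) -scalerBr.
rewrite (cl_opB mE) !(clX_scale mE) ff f'f !(cl_opN mE) ff.
by rewrite !opprK opprD !opprK addrACA addNr addr0 half.
Qed.

Lemma eig_sum_deg : degree0 eig_sum.
Proof.
move=> i w; rewrite eig_sumE dbl_grP /= !eig_grP => /andP[w1 w2].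
by rewrite rpredD // -(negbK i) (clX_gr mE).
Qed.

End Counit.

Section Unit.
Variable W : mobj N.
Let mD : is_cl_mod (eta2 eta) rho k (dbl k W) := modM (dbl_obj W).

Definition dbl_fst : 'Hom(eig_obj (dbl_obj W), W) :=
  linfun (fun w : subvs_of (eig (dbl k W)) => (vsval w : W * W).1).

Lemma dbl_fstE (w : eig_obj (dbl_obj W)) : dbl_fst w = (vsval w : W * W).1.
Proof. by apply: linfunE_lin => z u v; rewrite linearP. Qed.

Let ii0 : ii != 0.
Proof.
apply/eqP => i0; have := sqr_i R; rewrite i0 expr0n /= => /eqP.
by rewrite eq_sym oppr_eq0 oner_eq0.
Qed.

(* f f' (v, w) = (i v, - i w). *)
Let dbl_eig (v : W * W) : ((v : dbl k W) \in eig (dbl k W)) = (v.2 == 0).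
Proof.
case: v => v1 v2; apply/(sameP (eigP mD _)); apply: (iffP eqP) => /= [->|].
  by congr pair; rewrite /= ?opprK ?scaler0 ?oppr0.
case=> _ /eqP; rewrite eq_sym -addr_eq0 -scalerDr scaler_eq0 (negPf ii0) /=.
by rewrite -mulr2n -(scaler_nat _ v2) scaler_eq0 pnatr_eq0 => /eqP.
Qed.

Lemma dbl_fst_iso : mod_iso dbl_fst.
Proof.
split.
  move=> x w; rewrite !dbl_fstE eig_val /=.
  case: x => [a|x|g] //=; case: (phi g) => //=.
  by rewrite opprK.
exists (fun u => vsproj (eig (dbl k W)) ((u, 0) : W * W)) => [w|u].
  apply: subvs_inj; rewrite dbl_fstE.
  have := subvsP w; rewrite dbl_eig; case: (vsval w) => u v /= /eqP ->.
  by rewrite vsprojK // dbl_eig.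
by rewrite dbl_fstE vsprojK // dbl_eig.
Qed.

Lemma dbl_fst_deg : degree0 dbl_fst.
Proof. by move=> i w; rewrite dbl_fstE eig_grP dbl_grP => /andP[]. Qed.

End Unit.

(** Two anticommuting generators of square -1 make up a complex matrix algebra,
   so that removing them does not change the modules; since the eigenspace is
   not preserved by the antilinear operators, these change parity. *)
Lemma cl_remove_two : Kisomorphic M N.
Proof.
apply: (@kequivalence R M N eig_functor dbl_functor eig_sum dbl_fst).
- exact: eig_sum_iso.
- exact: eig_sum_deg.
- move=> E F s v ms; rewrite -[kf_map _ _]/(dbl_hom (eig_hom s)) dbl_homE !eig_sumE.
  by rewrite [fst (_, _)]/= [snd (_, _)]/= !eig_hom_val // linearD /= ms.
- exact: dbl_fst_iso.
- exact: dbl_fst_deg.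
- move=> E F s v ms; rewrite -[kf_map _ _]/(eig_hom (dbl_hom s)) !dbl_fstE.
  have md : mod_map (dbl_hom s) :=
    @kf_mod _ _ _ dbl_functor _ _ _ ms.
  by rewrite eig_hom_val // dbl_homE.
Qed.

End RemoveTwo.

(** * Crossed products by cohomologous twisted actions *)

Section Cohomologous.
Variables (R : realType) (G : magnetic) (A A' : magalg R G).
Variables (rho rho' : cocycle R G) (h : {lrmorphism A -> A'}) (w : G -> A').
Hypothesis h_bij : bijective h.
Hypothesis w_unit : forall g, w g \is a GRing.unit.
Hypothesis hw : forall g a, h (ma_act g a) * w g = w g * ma_act g (h a).
Hypothesis ww : forall g l : G,
  rho g l *: w (g * l)%g = rho' g l *: (w g * ma_act g (w l)).

Definition untwist (x : crossed A rho) : crossed A' rho' :=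
  [ffun g => h (x g) * w g].

Lemma untwist_linear : linear untwist.
Proof.
by move=> z x y; apply/ffunP => g; rewrite !ffunE linearP mulrDl scalerAl.
Qed.

Lemma untwist_monoid : monoid_morphism untwist.
Proof.
split.
  have w1 : w 1%g = (rho 1%g 1%g / rho' 1%g 1%g) *: 1.
    apply: (mulrI (w_unit 1%g)); rewrite -scalerAr mulr1.
    have := ww 1%g 1%g; rewrite mulg1 ma_act_id mulrC -scalerA => ->.
    by rewrite scalerA mulVf ?scale1r // cc_neq0.
  apply/ffunP => g; rewrite !ffunE; case: eqP => [->|_]; last by rewrite rmorph0 mul0r.
  rewrite linearZ rmorph1 w1 -scalerAl mul1r scalerA mulrA mulVf ?mul1r //.
  exact: cc_neq0.
move=> x y; apply/ffunP => m; rewrite !ffunE linear_sum mulr_suml.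
apply: eq_bigr => g _; rewrite linear_sum mulr_suml; apply: eq_bigr => l /eqP <-.
rewrite linearZ -scalerAl scalerAr ww -scalerAr !ffunE ma_actM rmorphM.
by rewrite -!mulrA [h (ma_act g _) * _]mulrA hw !mulrA.
Qed.

HB.instance Definition _ := GRing.isLinear.Build R[i] (crossed A rho)
  (crossed A' rho') _ untwist untwist_linear.
HB.instance Definition _ := GRing.isMonoidMorphism.Build (crossed A rho)
  (crossed A' rho') untwist untwist_monoid.

(** Replacing the basis elements [g] by w_g [g] conjugates the action by w_g and
   multiplies the cocycle by the coboundary of w. *)
Lemma crossed_untwist :
  exists f : {lrmorphism crossed A rho -> crossed A' rho'}, bijective f.
Proof.
exists untwist; have [h' hK h'K] := h_bij.
exists (fun y : crossed A' rho' => [ffun g => h' (y g * (w g)^-1)] : crossed A rho).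
  by move=> x; apply/ffunP => g; rewrite !ffunE mulrK.
by move=> y; apply/ffunP => g; rewrite !ffunE h'K mulrVK.
Qed.

End Cohomologous.

Section Quaternionic.
Variable R : realType.

Let Jpow (b : bool) : 'M[R[i]]_2 := if b then matJ R else 1.

Let Jpow_unit b : Jpow b \is a GRing.unit.
Proof. by case: b; rewrite ?unitr1 ?matJ_unit. Qed.

Let Jpow_act b X : adJK b X * Jpow b = Jpow b * map_mx (conjb b) X.
Proof.
case: b => /=; first by rewrite mulrVK ?matJ_unit.
by rewrite mulr1 mul1r; apply/matrixP => i j; rewrite mxE.
Qed.

(** J is real and squares to -1, the value of the cocycle at (1, 1). *)
Let Jpow_cocycle b c :
  Jpow (b (+) c) = sigma_fun R b c *: (Jpow b * map_mx (conjb b) (Jpow c)).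
Proof.
rewrite sigma_funE; case: b c => [] [] /=; rewrite ?[map_mx _ _]conj_matJ.
- by rewrite matJ_sq expr1 scaleN1r opprK.
- by rewrite [map_mx _ _](map_conjb1 R true) mulr1 expr0 scale1r.
- by rewrite mul1r scale1r; apply/matrixP => i j; rewrite [RHS]mxE.
- by rewrite mul1r scale1r; apply/matrixP => i j; rewrite [RHS]mxE.
Qed.

Lemma semidirect_M2 : exists f : {lrmorphism semidirect (magM2J R) ->
  crossed (magM2 R magZ2) (sigma R)}, bijective f.
Proof.
apply: (@crossed_untwist R magZ2 (magM2J R) (magM2 R magZ2) (one_cc R magZ2)
  (sigma R) (idfun : {lrmorphism mat2 R -> mat2 R}) Jpow).
- by exists id.
- exact: Jpow_unit.
- by move=> g X; apply: Jpow_act.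
- by move=> g l; rewrite scale1r; apply: Jpow_cocycle.
Qed.

Lemma semidirect_pullback_M2 (G : magnetic) :
  exists f : {lrmorphism semidirect (pullback_alg G (magM2J R)) ->
    crossed (magM2 R G) (pullback_cc G (sigma R))}, bijective f.
Proof.
apply: (@crossed_untwist R G (pullback_alg G (magM2J R)) (magM2 R G) (one_cc R G)
  (pullback_cc G (sigma R)) (idfun : {lrmorphism mat2 R -> mat2 R}) (Jpow \o phi)).
- by exists id.
- by move=> g; apply: Jpow_unit.
- by move=> g X; apply: Jpow_act.
- by move=> g l; rewrite scale1r /= phiM; apply: Jpow_cocycle.
Qed.

End Quaternionic.

(** * The periodicity *)

Section Periodicity.
Variables (R : realType) (G : magnetic) (A : magalg R G).
Local Notation clI p q := (@cl_modules R G A 'I_(p + q) (fun i => (p <= i)%N)).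

Lemma cl_two_negative p q rho k :
  Kisomorphic (clI p (q + 2) rho k) (clI p q (rho2 rho k) (~~ k)).
Proof.
have le2 : (p + q <= p + (q + 2))%N by rewrite addnA leq_addr.
have lt2 (b : bool) : (p + q + b < p + (q + 2))%N.
  by rewrite addnA ltn_add2l; case: b.
pose h (y : 'I_(p + q) + bool) : 'I_(p + (q + 2)) :=
  match y with inl i => widen_ord le2 i | inr b => Ordinal (lt2 b) end.
pose h' (j : 'I_(p + (q + 2))) : 'I_(p + q) + bool :=
  if insub (val j) is Some i then inl i else inr (val j != p + q)%N.
have hK : cancel h h'.
  move=> [i|b]; rewrite /h' /=; first by rewrite valK.
  rewrite insubF; last by rewrite ltnNge leq_addr.
  by rewrite -[X in _ != X]addn0 eqn_add2l; case: b.
have h'K : cancel h' h.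
  move=> j; apply: val_inj; rewrite /h'; case: insubP => [i _ //|] /=.
  have pq2 : (p + (q + 2) = (p + q).+2)%N by rewrite addnA addn2.
  have jle : (j <= (p + q).+1)%N := leq_trans (ltn_ord j) (eq_leq pq2).
  rewrite -leqNgt => pqj.
  have [->|ne] := eqVneq (val j) (p + q)%N; first by rewrite addn0.
  by apply/eqP; rewrite addn1 eqn_leq jle andbT ltn_neqAle eq_sym ne.
apply: Kisomorphic_trans (cl_reindex A _ rho k hK h'K) _.
rewrite (_ : _ \o h = eta2 (fun i : 'I_(p + q) => (p <= i)%N)).
  exact: cl_remove_two.
by apply/funext => -[i|b] //=; rewrite -addnA leq_addr.
Qed.

(** The first pass makes the antilinear operators odd, the second one makes
   them even again; only the first one changes the cocycle. *)
Lemma cl_four_negative p q :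
  Kisomorphic (clI p (q + 4) (one_cc R G) false)
              (clI p q (pullback_cc G (sigma R)) false).
Proof.
rewrite -[(q + 4)%N]/(q + (2 + 2))%N [(q + (2 + 2))%N]addnA.
apply: Kisomorphic_trans (cl_two_negative _ _ _ _) _.
apply: Kisomorphic_trans (cl_two_negative _ _ _ _) _.
have -> : (pullback_cc G (sigma R) : G -> G -> R[i]) =
    rho2 (rho2 (one_cc R G) false) true.
  by apply/funext => g; apply/funext => l; rewrite /rho2 /= sigma_funE mulr1 mul1r.
by exists id; split => //; exists id.
Qed.

Let sigma1 : pullback_cc G (sigma R) 1%g 1%g = 1.
Proof. by rewrite /= sigma_funE phi1. Qed.

Lemma equivariant_periodicity p q :
  Kisomorphic (equivariant_modules (magcliff A p (q + 4)))
              (crossed_modules (magcliff A p q) (pullback_cc G (sigma R))).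
Proof.
apply: Kisomorphic_trans (equivariant_cl _) _.
apply: Kisomorphic_trans (cliff_universal _ _ _ _) _.
apply: Kisomorphic_trans (cl_four_negative _ _) _.
apply: Kisomorphic_sym; apply: Kisomorphic_trans (crossed_cl _ sigma1) _.
exact: cliff_universal.
Qed.

Lemma crossed_periodicity p q :
  Kisomorphic (crossed_modules (magcliff A p (q + 4)) (one_cc R G))
              (crossed_modules (magcliff A p q) (pullback_cc G (sigma R))).
Proof.
apply: Kisomorphic_trans (equivariant_periodicity p q).
apply: Kisomorphic_trans (crossed_cl _ _) _ => //.
exact/Kisomorphic_sym/equivariant_cl.
Qed.

End Periodicity.

Lemma pullback_sigmaZ2 (R : realType) : pullback_cc magZ2 (sigma R) = sigma R.
Proof.
rewrite /pullback_cc /sigma; congr Cocycle; exact: Prop_irrelevance.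
Qed.

Theorem proposition3p4 (R : realType) :
  (exists f : {lrmorphism semidirect (magM2J R) ->
                          crossed (magM2 R magZ2) (sigma R)},
     bijective f) /\
  (forall G : magnetic,
     exists f : {lrmorphism semidirect (pullback_alg G (magM2J R)) ->
                            crossed (magM2 R G) (pullback_cc G (sigma R))},
       bijective f) /\
  (forall p q : nat,
     Kisomorphic (crossed_modules (cliffC R magZ2 p (q + 4)) (one_cc R magZ2))
                 (crossed_modules (cliffC R magZ2 p q) (sigma R))) /\
  (forall (G : magnetic) (p q : nat),
     Kisomorphic (crossed_modules (cliffC R G p (q + 4)) (one_cc R G))
                 (crossed_modules (cliffC R G p q)
                                  (pullback_cc G (sigma R)))) /\
  (forall (G : magnetic) (A : magalg R G) (p q : nat),
     graded_central A -> graded_simple A ->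
     Kisomorphic (equivariant_modules (magcliff A p (q + 4)))
                 (crossed_modules (magcliff A p q)
                                  (pullback_cc G (sigma R)))).
Proof.
split; first exact: semidirect_M2.
split; first exact: semidirect_pullback_M2.
split; first by move=> p q; rewrite -pullback_sigmaZ2; apply: crossed_periodicity.
split; first by move=> G p q; apply: crossed_periodicity.
by move=> G A p q _ _; apply: equivariant_periodicity.
Qed.
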